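(* Let $r$ be a fixed positive integer. There is a randomized polynomial-time algorithm that, given an instance of the Multiple Submodular Covering problem with $r$ constraints and a fixed $\epsilon>0$, outputs a set $S\subseteq N$ such that (i) $f_i(S)\ge (1-1/e-\epsilon)\,b_i$ for all $i\in[r]$, and (ii) $\mathbb{E}[c(S)]\le (1+\epsilon)\,\mathsf{OPT}$, where $\mathsf{OPT}$ is the cost of an optimal solution to the instance.
   Context: An instance of the Multiple Submodular Covering (MSC) problem consists of a finite ground set $N$, a non-negative cost function $c:N\to\mathbb{R}_+$ (with $c(S)=\sum_{e\in S}c(e)$), $r$ monotone submodular functions $f_1,\dots,f_r:2^N\to\mathbb{R}_+$ given by value oracles, and non-negative requirements $b_1,\dots,b_r$. The goal is to find $S\subseteq N$ minimizing $c(S)$ subject to $f_i(S)\ge b_i$ for all $i\in[r]$. $\mathsf{OPT}$ denotes the minimum cost of such a feasible set. *)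

(* Defs.v *)
From HB Require Import structures.
From mathcomp Require Import all_boot all_order all_algebra.
From mathcomp Require Import reals sequences exp.
Set Implicit Arguments. Unset Strict Implicit. Unset Printing Implicit Defensive.
Import Order.TTheory GRing.Theory Num.Theory.
Local Open Scope ring_scope.

Section MSC.
Variables (R : realType) (n r : nat).
Variables (c : 'I_n -> R) (b : 'I_r -> R) (f : 'I_r -> {set 'I_n} -> R).

Definition monotone_setfun (g : {set 'I_n} -> R) :=
  forall A B : {set 'I_n}, A \subset B -> g A <= g B.

Definition submodular_setfun (g : {set 'I_n} -> R) :=
  forall A B : {set 'I_n}, g (A :|: B) + g (A :&: B) <= g A + g B.

Definition msc_instance :=
  (forall e, 0 <= c e) /\ (forall i, 0 <= b i) /\
  (forall i, (forall S, 0 <= f i S) /\ monotone_setfun (f i) /\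
             submodular_setfun (f i)).

Definition set_cost (S : {set 'I_n}) : R := \sum_(e in S) c e.

Definition msc_feasible_set (S : {set 'I_n}) : bool :=
  [forall i, b i <= f i S].

Definition msc_feasible := exists S, msc_feasible_set S.

(* OPT = minimum cost of a feasible set (the default value c(N) is
   irrelevant for feasible instances: by monotonicity N is feasible and
   is in the index range). *)
Definition msc_opt : R :=
  \big[Num.min/set_cost [set: 'I_n]%SET]_(S : {set 'I_n} | msc_feasible_set S) set_cost S.
End MSC.

(* Model of computation: a randomized real-RAM (algebraic / BSS-style) *)
(* with a value oracle.  Unit cost per instruction.                    *)
(*  - nat registers N[.] (with +, truncated -, comparison only: no     *)
(*    unit-cost multiplication), indirect addressing;                  *)
(*  - real registers X[.] with +,-,*,/ and comparison; the only real   *)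
(*    constants are 0 and 1; nat -> real conversion, no floor;         *)
(*  - a bit buffer B[.] describing the current set {e < n | B[e]};     *)
(* Input convention: N[0] = n, N[1] = r.  Output: the set in B at halt.*)
Inductive instr : Type :=
| NConst  (d k : nat)
| NAdd    (d a a' : nat)
| NSub    (d a a' : nat)         (* N[d] := N[a] - N[a'] (truncated) *)
| NLoad   (d p : nat)
| NStore  (p s : nat)
| NJumpLe (a a' t : nat)
| XZero   (d : nat)
| XOne    (d : nat)
| XAdd    (d a a' : nat)
| XSub    (d a a' : nat)
| XMul    (d a a' : nat)
| XDiv    (d a a' : nat)         (* x / 0 = 0 *)
| XOfNat  (d a : nat)
| XLoad   (d p : nat)
| XStore  (p s : nat)
| XJumpLe (a a' t : nat)
| SetBit  (p v : nat)
| GetBit  (d p : nat)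
| Cost    (d p : nat)
| Req     (d p : nat)
| Query   (d p : nat)
| Flip    (d : nat)
| Goto    (t : nat).

Record mstate (R : Type) := MState {
  nreg : nat -> nat; xreg : nat -> R; bits : nat -> bool;
  pc : nat; flips : nat }.

Definition upd {T : Type} (g : nat -> T) (j : nat) (v : T) : nat -> T :=
  fun i => if i == j then v else g i.

Section Machine.
Variables (R : realType) (n r : nat).
Variables (c : 'I_n -> R) (b : 'I_r -> R) (f : 'I_r -> {set 'I_n} -> R).
Variables (coins : nat -> bool) (prog : seq instr).

Definition bufset (s : mstate R) : {set 'I_n} := [set e : 'I_n | bits s (val e)].

Definition init_state : mstate R :=
  MState (upd (upd (fun _ => 0%N) 0 n) 1 r) (fun _ => 0) (fun _ => false) 0 0.

Definition step (s : mstate R) : mstate R :=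
  let N := nreg s in let X := xreg s in let B := bits s in
  let q := pc s in let fl := flips s in
  let nx := q.+1 in
  let setN d v := MState (upd N d v) X B nx fl in
  let setX d v := MState N (upd X d v) B nx fl in
  if (size prog <= q)%N then s else
  match nth (Goto q) prog q with
  | NConst d k => setN d k
  | NAdd d a a' => setN d (N a + N a')%N
  | NSub d a a' => setN d (N a - N a')%N
  | NLoad d p => setN d (N (N p))
  | NStore p s' => setN (N p) (N s')
  | NJumpLe a a' t => MState N X B (if (N a <= N a')%N then t else nx) fl
  | XZero d => setX d 0
  | XOne d => setX d 1
  | XAdd d a a' => setX d (X a + X a')
  | XSub d a a' => setX d (X a - X a')
  | XMul d a a' => setX d (X a * X a')
  | XDiv d a a' => setX d (X a / X a')
  | XOfNat d a => setX d (N a)%:R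
  | XLoad d p => setX d (X (N p))
  | XStore p s' => setX (N p) (X s')
  | XJumpLe a a' t => MState N X B (if X a <= X a' then t else nx) fl
  | SetBit p v => MState N X (upd B (N p) (N v != 0%N)) nx fl
  | GetBit d p => setN d (nat_of_bool (B (N p)))
  | Cost d p => setX d (match (insub (N p) : option 'I_n) with
                        | Some e => c e | None => 0 end)
  | Req d p => setX d (match (insub (N p) : option 'I_r) with
                       | Some i => b i | None => 0 end)
  | Query d p => setX d (match (insub (N p) : option 'I_r) with
                         | Some i => f i (bufset s) | None => 0 end)
  | Flip d => MState (upd N d (nat_of_bool (coins fl))) X B nx fl.+1
  | Goto t => MState N X B t fl
  end.

Definition run (k : nat) : mstate R := iter k step init_state.

Definition halted (s : mstate R) : bool := (size prog <= pc s)%N.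
End Machine.

Definition coins_of (T : nat) (w : {ffun 'I_T -> bool}) : nat -> bool :=
  fun j => match (insub j : option 'I_T) with Some i => w i | None => false end.

(* Expected cost of the output of [prog] run for T steps, over T fair coins
   (a run of T steps uses at most T coins, so this is the exact expectation). *)
Definition expected_output_cost (R : realType) (n r : nat)
  (c : 'I_n -> R) (b : 'I_r -> R) (f : 'I_r -> {set 'I_n} -> R)
  (prog : seq instr) (T : nat) : R :=
  (\sum_(w : {ffun 'I_T -> bool})
      set_cost c (@bufset R n (run c b f (coins_of w) prog T))) / (2 ^+ T).

(* Main.v *)
Require Import Defs.
From HB Require Import structures.
From mathcomp Require Import all_boot all_order all_algebra.
From mathcomp Require Import reals sequences exp.
From mathcomp Require Import ring lra zify.
Import Order.TTheory GRing.Theory Num.Theory.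
Local Open Scope ring_scope.

(* The algorithm is a deterministic greedy, so the coins are never used.  Let
   u_i(S) = max(0, b_i - f_i(S)) / b_i be the relative deficit and
   G(S) = sum_i u_i(S)^p for a large constant p.  Guess, by enumerating all sets
   of constant size, a part A of an optimal set O that contains its most
   expensive elements and all those of large marginal value.  Then repeatedly
   add the element e, among those of cost at most c(A) / K, that maximises
   (G(S) - G(S+e)) / c(e).  The deficits are supermodular and the marginals of
   O \ A are small, so that the total gain over O \ A is at least
   p (1 - delta) G(S), and the chosen e satisfies
   G(S+e) <= G(S) exp(- p (1 - delta) c(e) / c(O \ A)).
   Hence once c(O \ A) has been spent, G <= r exp(- p (1 - delta)) <= theta^p
   for a fixed theta > 1/e, and every deficit is at most theta.  The last element
   overshoots by at most c(A) / K <= eps OPT.  Keeping the cheapest set ever met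
   whose deficits are all at most theta makes the covering guarantee
   unconditional. *)

(** * Analysis of the greedy algorithm *)

Section Powers.
Variable R : realType.

(** Convexity: the power lies above its tangent at [y]. *)
Lemma subX_ge (x y : R) (q : nat) : 0 <= y -> y <= x ->
  q.+1%:R * (x - y) * y ^+ q <= x ^+ q.+1 - y ^+ q.+1.
Proof.
move=> y0 yx; elim: q => [|q IH]; first by rewrite !expr1 expr0 mul1r mulr1.
have xy : x ^+ q.+2 - y ^+ q.+2 = x * (x ^+ q.+1 - y ^+ q.+1) + (x - y) * y ^+ q.+1.
  by rewrite [x ^+ _]exprS [y ^+ q.+2]exprS; ring.
have h : y * (q.+1%:R * (x - y) * y ^+ q) <= x * (x ^+ q.+1 - y ^+ q.+1).
  by apply: ler_pM => //; rewrite !mulr_ge0 ?exprn_ge0 ?subr_ge0.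
rewrite xy -(natr1 q.+1); apply: le_trans (lerD h (lexx _)).
by rewrite exprS le_eqVlt; apply/orP; left; apply/eqP; ring.
Qed.

(** The difference is x - y times a sum of [q] monomials, each at most 1 on the unit interval. *)
Lemma subX_le (x y : R) (q : nat) : 0 <= y -> y <= x -> x <= 1 ->
  x ^+ q - y ^+ q <= q%:R * (x - y).
Proof.
move=> y0 yx x1; elim: q => [|q IH]; first by rewrite !expr0 mul0r subrr.
have -> : x ^+ q.+1 - y ^+ q.+1 = x * (x ^+ q - y ^+ q) + (x - y) * y ^+ q.
  by rewrite !exprS; ring.
have yq : y ^+ q <= 1 by apply: exprn_ile1 => //; exact: le_trans x1.
have xq : 0 <= x ^+ q - y ^+ q by rewrite subr_ge0 lerXn2r ?nnegrE //; lra.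
rewrite -natr1; set a := x ^+ q - _ in IH xq *; set z := y ^+ q in yq *; nra.
Qed.

End Powers.

(** * Diminishing returns for decreasing supermodular functions *)

Section Supermodular.
Variables (R : realType) (n : nat) (u : {set 'I_n} -> R).
Hypothesis u_anti : forall A B : {set 'I_n}, A \subset B -> u B <= u A.
Hypothesis u_super : forall A B : {set 'I_n}, u A + u B <= u (A :|: B) + u (A :&: B).

Lemma marginal_ge0 (A : {set 'I_n}) e : 0 <= u A - u (e |: A).
Proof. by rewrite subr_ge0 u_anti // subsetUr. Qed.

(** For [e] outside [S], this is supermodularity for [S] and [e |: A], whose union is [e |: S] and
    whose intersection is [A]. *)
Lemma marginal_anti (A S : {set 'I_n}) e : A \subset S ->
  u S - u (e |: S) <= u A - u (e |: A).
Proof.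
move=> AS; have [eS|eS] := boolP (e \in S).
  have -> : e |: S = S by apply/setUidPr; rewrite sub1set.
  by rewrite subrr marginal_ge0.
have := u_super S (e |: A).
have -> : S :|: (e |: A) = e |: S.
  by rewrite setUCA; congr (_ |: _); apply/setUidPl.
have -> : S :&: (e |: A) = A.
  apply/setP=> x; rewrite !inE; have [->|_] /= := eqVneq x e.
    by rewrite andbT (negPf eS); apply/esym/negbTE; apply: contra eS; apply/subsetP.
  by have [/(subsetP AS) ->|] := boolP (x \in A); rewrite ?andbF.
lra.
Qed.

(** Add the elements of [T] one at a time; by diminishing returns each drop is at most the drop of
    the same element at [S]. *)
Lemma sum_marginal_ge (S T : {set 'I_n}) :
  u S - u (S :|: T) <= \sum_(e in T) (u S - u (e |: S)).
Proof.
have [k] := ubnP #|T|; elim: k T => // k IH T Tk.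
have [->|[e eT]] := set_0Vmem T; first by rewrite big_set0 setU0 subrr.
rewrite (big_setD1 e) //=.
have h : u S - u (S :|: T :\ e) <= \sum_(i in T :\ e) (u S - u (i |: S)).
  by apply: IH; move: Tk; rewrite (cardsD1 e) eT.
have := @marginal_anti S (S :|: T :\ e) e (subsetUl _ _).
have -> : e |: (S :|: T :\ e) = S :|: T by rewrite setUCA setD1K.
lra.
Qed.

End Supermodular.

(** * Relative deficits, the potential and the guess *)

Section MSC.
Variables (R : realType) (n r : nat).
Variables (c : 'I_n -> R) (b : 'I_r -> R) (f : 'I_r -> {set 'I_n} -> R).
Hypothesis inst : msc_instance c b f.

Notation cost := (set_cost c).

(** Division by zero yields 0, so a requirement [b i = 0] counts as met. *)
Definition deficit (i : 'I_r) (S : {set 'I_n}) : R := Num.max 0 (b i - f i S) / b i.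

Definition potential (p : nat) (S : {set 'I_n}) : R := \sum_i deficit i S ^+ p.

Definition relaxed (rho : R) (S : {set 'I_n}) : bool :=
  [forall i, rho * b i <= f i S].

Let c_ge0 e : 0 <= c e. Proof. by case: inst. Qed.
Let b_ge0 i : 0 <= b i. Proof. by case: inst => _ []. Qed.
Let f_ge0 i S : 0 <= f i S. Proof. by case: inst => _ [_ /(_ i)] []. Qed.
Let f_mono i : monotone_setfun (f i). Proof. by case: inst => _ [_ /(_ i)] [_ []]. Qed.
Let f_sub i : submodular_setfun (f i). Proof. by case: inst => _ [_ /(_ i)] [_ []]. Qed.

Lemma deficit_ge0 i S : 0 <= deficit i S.
Proof. by apply: divr_ge0; rewrite ?le_max ?lexx. Qed.

Lemma deficit_le1 i S : deficit i S <= 1.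
Proof.
rewrite /deficit; have [->|bi] := eqVneq (b i) 0; first by rewrite invr0 mulr0.
by rewrite ler_pdivrMr ?lt_def ?bi //= mul1r ge_max b_ge0 /= gerBl.
Qed.

Lemma deficit_anti i (A B : {set 'I_n}) : A \subset B -> deficit i B <= deficit i A.
Proof.
move=> /(f_mono i) AB; apply: ler_wpM2r; first by rewrite invr_ge0.
by rewrite ge_max !le_max lexx /= lerD2l lerN2 AB orbT.
Qed.

(** Truncation at 0 is convex and nondecreasing, which preserves supermodularity of a decreasing
    function. The monotonicity facts order the four values, and a case split on signs finishes. *)
Lemma deficit_super i (A B : {set 'I_n}) :
  deficit i A + deficit i B <= deficit i (A :|: B) + deficit i (A :&: B).
Proof.
rewrite /deficit -!mulrDl; apply: ler_wpM2r; first by rewrite invr_ge0.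
have h1 := f_sub i A B.
have h2 := f_mono i A (A :|: B) (subsetUl _ _).
have h3 := f_mono i B (A :|: B) (subsetUr _ _).
have h4 := f_mono i (A :&: B) A (subsetIl _ _).
have h5 := f_mono i (A :&: B) B (subsetIr _ _).
by rewrite !maxEle; do ! case: ifPn; rewrite -?ltNge; lra.
Qed.

Lemma deficit_feasible i S : msc_feasible_set b f S -> deficit i S = 0.
Proof.
by move=> /forallP/(_ i) h; rewrite /deficit max_l ?mul0r // subr_le0.
Qed.

Lemma potential_le p S : potential p S <= r%:R.
Proof.
rewrite -[r in leRHS]card_ord -sum1_card natr_sum.
by apply: ler_sum => i _; rewrite exprn_ile1 ?deficit_ge0 ?deficit_le1.
Qed.

(** A violated constraint has deficit at least 1 - rho and contributes enough on its own. Read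
    contrapositively, a small potential certifies relaxed feasibility. *)
Lemma potential_relaxed rho p S : rho <= 1 ->
  ~~ relaxed rho S -> (1 - rho) ^+ p <= potential p S.
Proof.
move=> rho1; rewrite negb_forall => /existsP[i]; rewrite -ltNge => lt.
have bi : 0 < b i.
  rewrite lt_def b_ge0 andbT; apply/eqP => b0; move: lt.
  by rewrite b0 mulr0 ltNge f_ge0.
have h : 1 - rho <= deficit i S.
  rewrite /deficit ler_pdivlMr // le_max; apply/orP; right; lra.
rewrite /potential (bigD1 i) //=.
apply: (@le_trans _ _ (deficit i S ^+ p)).
  by rewrite lerXn2r ?nnegrE ?deficit_ge0 ?subr_ge0.
by rewrite lerDl sumr_ge0 // => j _; rewrite exprn_ge0 ?deficit_ge0.
Qed.

Lemma cost_ge0 (S : {set 'I_n}) : 0 <= cost S. Proof. exact: sumr_ge0. Qed.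

Lemma cost_setU1 e (S : {set 'I_n}) : e \notin S -> cost (e |: S) = c e + cost S.
Proof. exact: big_setU1. Qed.

Lemma cost_setD (A S : {set 'I_n}) : A \subset S -> cost S = cost A + cost (S :\: A).
Proof.
by move=> AS; rewrite /set_cost (big_setID A) /= (setIidPr AS).
Qed.

Section Potential_gain.
Variables (opt A : {set 'I_n}) (eta : R).
Hypothesis opt_feas : msc_feasible_set b f opt.
Hypothesis small_marginal : forall i e, e \in opt :\: A ->
  deficit i A - deficit i (e |: A) <= eta.
Hypothesis eta_ge0 : 0 <= eta.

(** Each power drops by at least its tangent bound at the new deficit z, and z >= y because
    marginals are at most [eta] at [A] and only shrink at [S]. The drops x - z add up to at least x,
    as adding all of [opt] leaves deficit 0, and x y^q >= x^(q+1) - q eta. *)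
Lemma potential_gain q (S : {set 'I_n}) : A \subset S ->
  q.+1%:R * (potential q.+1 S - r%:R * q%:R * eta) <=
  \sum_(e in opt :\: A) (potential q.+1 S - potential q.+1 (e |: S)).
Proof.
move=> AS; rewrite /potential.
rewrite (eq_bigr (fun e => \sum_i (deficit i S ^+ q.+1 - deficit i (e |: S) ^+ q.+1))); last first.
  by move=> e _; rewrite sumrB.
rewrite exchange_big /=.
have -> : r%:R * q%:R * eta = \sum_(i < r) (q%:R * eta) :> R.
  by rewrite sumr_const card_ord -[RHS]mulr_natl mulrA.
rewrite -sumrB mulr_sumr; apply: ler_sum => i _.
set x := deficit i S; set y := Num.max 0 (x - eta).
have x0 : 0 <= x := deficit_ge0 i S.
have x1 : x <= 1 := deficit_le1 i S.
have y0 : 0 <= y by rewrite le_max lexx.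
have yx : y <= x by rewrite ge_max x0 /= gerBl.
have xy : x - y <= eta.
  by rewrite /y maxEle; case: ifPn; rewrite -?ltNge; lra.
have h1 : x ^+ q.+1 - q%:R * eta <= x * y ^+ q.
  have := @subX_le R x y q y0 yx x1; have : 0 <= x ^+ q - y ^+ q.
    by rewrite subr_ge0 lerXn2r ?nnegrE.
  have q0 : 0 <= q%:R :> R by [].
  rewrite exprS; nra.
have hm e : e \in opt :\: A ->
    q.+1%:R * (x - deficit i (e |: S)) * y ^+ q <= x ^+ q.+1 - deficit i (e |: S) ^+ q.+1.
  move=> eo; set z := deficit i (e |: S).
  have zx : z <= x by apply: deficit_anti; exact: subsetUr.
  have yz : y <= z.
    rewrite ge_max deficit_ge0 /=.
    have := @marginal_anti R n _ (deficit_anti i) (deficit_super i) A S e AS.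
    have := small_marginal i e eo; rewrite -/x -/z; lra.
  apply: le_trans (subX_ge _ x z q (deficit_ge0 _ _) zx).
  by rewrite ler_wpM2l ?mulr_ge0 ?subr_ge0 // lerXn2r ?nnegrE ?deficit_ge0.
apply: le_trans (ler_sum _ hm).
rewrite -mulr_suml -mulr_sumr -mulrA; apply: ler_wpM2l => //.
apply: le_trans h1 _; apply: ler_wpM2r; first exact: exprn_ge0.
have := @sum_marginal_ge R n _ (deficit_anti i) (deficit_super i) S (opt :\: A).
suff -> : deficit i (S :|: opt :\: A) = 0 by rewrite subr0.
apply/le_anti; rewrite deficit_ge0 andbT -(deficit_feasible i _ opt_feas).
apply: deficit_anti; apply/subsetP => e eo; rewrite !inE eo andbT.
by have [/(subsetP AS) ->|_] := boolP (e \in A); rewrite ?orbT.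
Qed.

End Potential_gain.

(** Take the [K] most expensive elements of [opt], then add elements whose marginal exceeds [eta] as
    long as there are any. Each of these lowers the total deficit, at most [r] initially, by more
    than [eta], so this ends before [L] additions. *)
Lemma good_guess (opt : {set 'I_n}) (K L : nat) (eta : R) :
  0 <= eta -> r%:R < L%:R * eta ->
  exists A : {set 'I_n}, [/\ A \subset opt, (#|A| <= K + L)%N,
    (forall e, e \in opt :\: A -> K%:R * c e <= cost A) &
    (forall i e, e \in opt :\: A -> deficit i A - deficit i (e |: A) <= eta)].
Proof.
move=> eta0 Leta.
have [A0 [A0o A0K cA0]] : exists A : {set 'I_n}, [/\ A \subset opt, (#|A| <= K)%N &
    forall e, e \in opt :\: A -> K%:R * c e <= cost A].
  elim: K => [|K [A [Ao AK cA]]].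
    exists set0; rewrite sub0set cards0; split=> // e _.
    by rewrite mul0r cost_ge0.
  have [D0|[e0 e0D]] := set_0Vmem (opt :\: A).
    by exists A; split=> //; [exact: leqW|move=> e; rewrite D0 in_set0].
  (* The most expensive remaining [a] joins the guess: every later [e] costs at most [c a], which
     pays for one more copy of [c e]. *)
  case: (Order.TotalTheory.arg_maxP c e0D) => a aD0 amax.
  have aD : a \in opt :\: A := aD0.
  have aA : a \notin A by move: aD; rewrite inE => /andP[].
  have ao : a \in opt by move: aD; rewrite inE => /andP[].
  exists (a |: A); split.
  - by rewrite subUset sub1set ao.
  - by rewrite cardsU1 aA.
  - move=> e; rewrite !inE negb_or -andbA => /and3P[ea eA eo].
    rewrite cost_setU1 // -natr1 mulrDl mul1r addrC lerD //.
      have eD : e \in opt :\: A by rewrite inE eA.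
      exact: amax _ eD.
    by apply: cA; rewrite inE eA.
have good k : exists A : {set 'I_n}, [/\ A \subset opt, (#|A| <= K + k)%N,
    (forall e, e \in opt :\: A -> K%:R * c e <= cost A) &
    (forall i e, e \in opt :\: A -> deficit i A - deficit i (e |: A) <= eta)
    \/ \sum_i deficit i A <= r%:R - k%:R * eta].
  elim: k => [|k [A [Ao AK cA]]].
    exists A0; rewrite addn0; split=> //; right.
    rewrite mul0r subr0 -[r in leRHS]card_ord -sum1_card natr_sum.
    by apply: ler_sum => i _; exact: deficit_le1.
  case=> [gA|sA]; first by exists A; split => //; [rewrite addnS leqW|left].
  have [/forallP H|] := boolP [forall i, [forall (e | e \in opt :\: A),
      deficit i A - deficit i (e |: A) <= eta]].
    exists A; split=> //; first by rewrite addnS leqW.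
    by left=> i e eo; exact: (forall_inP (H i)).
  rewrite negb_forall => /existsP[i]; rewrite negb_forall => /existsP[a].
  rewrite negb_imply -ltNge => /andP[aD lt].
  have aA : a \notin A by move: aD; rewrite inE => /andP[].
  have ao : a \in opt by move: aD; rewrite inE => /andP[].
  exists (a |: A); split.
  - by rewrite subUset sub1set ao.
  - by rewrite cardsU1 aA addnS.
  - move=> e; rewrite !inE negb_or -andbA => /and3P[ea eA eo].
    rewrite cost_setU1 //; apply: (le_trans (cA e _)); first by rewrite inE eA.
    by rewrite lerDr.
  - right; have : \sum_j deficit j (a |: A) <= \sum_j deficit j A - eta.
      rewrite (bigD1 i) //= [in leRHS](bigD1 i) //=.
      have : \sum_(j < r | j != i) deficit j (a |: A) <= \sum_(j < r | j != i) deficit j A.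
        by apply: ler_sum => j _; apply: deficit_anti; exact: subsetUr.
      by lra.
    by rewrite -natr1; lra.
have [A [Ao AK cA [gA|sA]]] := good L; first by exists A.
have : 0 <= \sum_i deficit i A by apply: sumr_ge0 => i _; exact: deficit_ge0.
by lra.
Qed.

(** * The greedy phase from a good guess *)

Section Greedy.
Variables (rho eta delta : R) (q K : nat) (opt A : {set 'I_n}).
Hypotheses (rho1 : rho < 1) (eta0 : 0 <= eta) (delta0 : 0 < delta) (delta1 : delta < 1).
Hypothesis eta_small : r%:R * q%:R * eta <= delta * (1 - rho) ^+ q.+1.
Hypothesis exp_small : r%:R * expR (- (q.+1%:R * (1 - delta))) <= (1 - rho) ^+ q.+1.
Hypothesis K0 : (0 < K)%N.
Hypotheses (opt_feas : msc_feasible_set b f opt) (Aopt : A \subset opt).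
Hypothesis cheap : forall e, e \in opt :\: A -> K%:R * c e <= cost A.
Hypothesis small_marginal : forall i e, e \in opt :\: A ->
  deficit i A - deficit i (e |: A) <= eta.

Let beta : R := q.+1%:R * (1 - delta).

Definition gain (S : {set 'I_n}) e := potential q.+1 S - potential q.+1 (e |: S).

(* The last alternative of [greedy_choice] is the dummy choice with gain 0 and
   cost 1 with which the search for the best ratio is initialised. *)
Definition greedy_choice (cA : R) (S S' : {set 'I_n}) : Prop :=
  exists g k : R, (forall e, K%:R * c e <= cA -> gain S e * k <= g * c e) /\
   ((exists e, [/\ K%:R * c e <= cA, 0 < g, g = gain S e, k = c e & S' = e |: S])
   \/ [/\ g = 0, k = 1 & S' = S]).

(** The cost of [opt :\: A] may be 0, so the exponent divides by any positive [D] that bounds it.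
    The bound on [#|S|] limits the number of rounds. *)
Definition greedy_inv t (S : {set 'I_n}) : Prop :=
  [/\ A \subset S, (t <= #|S|)%N, ~~ relaxed rho S &
      forall D, 0 < D -> cost (opt :\: A) <= D ->
        potential q.+1 S <= r%:R * expR (- (beta * ((cost S - cost A) / D)))].

Let beta_gt0 : 0 < beta.
Proof. by rewrite mulr_gt0 // subr_gt0. Qed.

Lemma greedy_inv_init : ~~ relaxed rho A -> greedy_inv 0 A.
Proof.
move=> nA; split=> // D D0 _.
by rewrite subrr mul0r mulr0 oppr0 expR0 mulr1 potential_le.
Qed.

(** Had more than [D] been spent beyond [A], the potential would be below r exp(-beta), hence too
    small for a set that is not relaxed-feasible. Here [D] exceeds the cost of [opt :\: A] by an
    arbitrary d > 0. *)
Lemma greedy_inv_cost t S : greedy_inv t S -> cost S <= cost opt.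
Proof.
move=> [AS _ nS pS]; rewrite (cost_setD _ _ Aopt) -lerBlDl.
apply/ler_addgt0Pr => d d0.
set D := cost (opt :\: A) + d.
have D0 : 0 < D by rewrite ltr_wpDl ?cost_ge0.
have {}pS := pS D D0; have : cost (opt :\: A) <= D by rewrite lerDl ltW.
move=> /pS {}pS; rewrite leNgt; apply/negP => DS.
have h := potential_relaxed _ q.+1 _ (ltW rho1) nS.
have : r%:R * expR (- (beta * ((cost S - cost A) / D))) < r%:R * expR (- beta).
  have r0 : (0 < r)%N.
    by move: nS; rewrite negb_forall => /existsP[i _]; exact: leq_ltn_trans (ltn_ord i).
  rewrite ltr_pM2l ?ltr0n // ltr_expR ltrN2 -[ltLHS]mulr1 ltr_pM2l //.
  by rewrite ltr_pdivlMr // mul1r.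
by move: exp_small; rewrite -/beta; lra.
Qed.

(** Summing the optimality of the ratio over [opt :\: A] shows that the gain per cost is at least
    beta times the potential over the cost of [opt :\: A]. Before the step the cost is at most that
    of [opt], so only the added element can overshoot. *)
Lemma greedy_step t S S' : greedy_inv t S -> greedy_choice (cost A) S S' ->
  cost S' <= (1 + K%:R^-1) * cost opt /\ (relaxed rho S' \/ greedy_inv t.+1 S').
Proof.
move=> inv [g [k [best choice]]]; have cS := greedy_inv_cost _ _ inv.
case: inv => AS tS nS pS.
have pge := potential_relaxed _ q.+1 _ (ltW rho1) nS.
have p0 : 0 < potential q.+1 S.
  by apply: lt_le_trans pge; rewrite exprn_gt0 // subr_gt0.
(* The error r q eta is at most delta times the potential, because [S] is not relaxed-feasible. *)
have tot : beta * potential q.+1 S <= \sum_(e in opt :\: A) gain S e.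
  apply: le_trans (potential_gain _ _ _ opt_feas small_marginal eta0 q S AS).
  rewrite -[beta * _]mulrA; apply: ler_wpM2l => //.
  have := ler_wpM2l (ltW delta0) pge; move: eta_small; lra.
have k0 : 0 <= k by case: choice => [[e [_ _ _ -> _]]|[_ -> _]].
have key : beta * potential q.+1 S * k <= g * cost (opt :\: A).
  apply: (@le_trans _ _ ((\sum_(e in opt :\: A) gain S e) * k)).
    by rewrite ler_wpM2r.
  rewrite mulr_suml mulr_sumr; apply: ler_sum => e eo.
  by apply: best; exact: cheap.
(* The dummy choice would make [key] say that a positive number is at most 0. *)
case: choice => [[e [ce g0 gE kE ->]]|[g0 k1 _]]; last first.
  by move: key; rewrite g0 k1 mul0r mulr1 leNgt mulr_gt0.
have eS : e \notin S.
  apply/negP => eS; move: g0; rewrite gE /gain.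
  have -> : e |: S = S by apply/setUidPr; rewrite sub1set.
  by rewrite subrr ltxx.
split.
  rewrite cost_setU1 // mulrDl mul1r addrC lerD //.
  rewrite ler_pdivlMl ?ltr0n //; apply: le_trans ce _.
  by rewrite (cost_setD _ _ Aopt) lerDl cost_ge0.
have [|nS'] := boolP (relaxed rho (e |: S)); [by left|right].
split=> //.
- by apply: subset_trans AS _; exact: subsetUr.
- by rewrite cardsU1 eS.
move=> D D0 cD; have {}pS := pS D D0 cD.
have -> : cost (e |: S) - cost A = (cost S - cost A) + c e by rewrite cost_setU1 //; ring.
rewrite mulrDl mulrDr opprD expRD mulrA.
have gD : beta * potential q.+1 S * (c e / D) <= g.
  rewrite mulrA ler_pdivrMr // -kE; apply: le_trans key _.
  by rewrite ler_wpM2l // ltW.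
have -> : potential q.+1 (e |: S) = potential q.+1 S - g by rewrite gE /gain; ring.
(* This uses 1 - x <= exp(-x). *)
apply: (@le_trans _ _ (potential q.+1 S * expR (- (beta * (c e / D))))).
  have := expR_ge1Dx (- (beta * (c e / D))); nra.
by rewrite ler_wpM2r // expR_ge0.
Qed.

Lemma greedy_inv_stop t S : greedy_inv t S -> (t <= n)%N.
Proof. by case=> _ tS _ _; apply: (leq_trans tS); rewrite -[leqRHS]card_ord max_card. Qed.

End Greedy.

(** The default value of the minimum is the cost of the whole ground set, itself feasible by
    monotonicity. *)
Lemma msc_opt_attained : msc_feasible b f ->
  exists2 S, msc_feasible_set b f S & cost S <= msc_opt c b f.
Proof.
move=> [S0 S0f].
have Tf : msc_feasible_set b f [set: 'I_n].
  apply/forallP => i; apply: (le_trans (forallP S0f i)).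
  by apply: f_mono; exact: subsetT.
rewrite /msc_opt; apply: (big_ind (fun v => exists2 S, msc_feasible_set b f S & cost S <= v)).
- by exists [set: 'I_n].
- move=> x y [S1 f1 c1] [S2 f2 c2].
  by rewrite minEle; case: ifP => _; [exists S1|exists S2].
- by move=> S Sf; exists S.
Qed.

End MSC.

(* Writing [theta = 1 - rho > 1/e], the choice [delta = (1 + ln theta) / 2]
   makes [theta * e ^ (1 - delta) > 1], so that its powers exceed [r]. *)
Lemma potential_parameters (R : realType) (r : nat) (rho : R) : (0 < r)%N ->
  0 <= rho -> rho < 1 - (expR 1)^-1 ->
  exists (delta : R) (q : nat), [/\ 0 < delta, delta < 1 &
    r%:R * expR (- (q.+1%:R * (1 - delta))) <= (1 - rho) ^+ q.+1].
Proof.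
move=> r0 rho0 rhoe.
have e0 : 0 < (expR 1)^-1 :> R by rewrite invr_gt0 expR_gt0.
have th0 : 0 < 1 - rho by lra.
have lnth : -1 < ln (1 - rho).
  by rewrite -ltr_expR lnK ?posrE // expRN; lra.
have lnth0 : ln (1 - rho) <= 0 by apply: ln_le0; lra.
set d := (1 + ln (1 - rho)) / 2.
have d0 : 0 < d by rewrite /d; lra.
have d1 : d < 1 by rewrite /d; lra.
exists d, (Num.bound (ln r%:R / d)); split => //.
set q := Num.bound _.
(* In logarithms the goal reads ln r - (q+1)(1-d) <= (q+1)(2d-1), which is this inequality. *)
have hq : ln r%:R <= q.+1%:R * d.
  rewrite -ler_pdivrMr //; apply: (@le_trans _ _ q%:R); last by rewrite ler_nat.
  apply: ltW; apply: archi_boundP; apply: divr_ge0; last exact: ltW.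
  by rewrite ln_ge0 // ler1n.
rewrite -[r%:R]lnK ?posrE ?ltr0n // -[1 - rho in leRHS]lnK ?posrE //.
rewrite -expRD -expRM_natl ler_expR.
have -> : ln (1 - rho) = 2 * d - 1 by rewrite /d; lra.
set Q : R := q.+1%:R in hq *; nra.
Qed.

(** * A structured language compiled to the machine *)

(* [IfX a a' c1 c2] tests [X[a] <= X[a']].  [For d c] runs [c] with [N[d]] equal
   to [0, ..., n] in turn, where [n] is the input size held in [N[0]]; it uses
   [N[1]] as scratch space.  Every loop is thus bounded by [n.+1], so that every
   program runs in polynomial time. *)
Inductive cmd : Type :=
| Do (i : instr)
| Sq (c1 c2 : cmd)
| IfX (a a' : nat) (c1 c2 : cmd)
| Rep (m : nat) (c : cmd)
| For (d : nat) (c : cmd).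

(** The body never runs, but [writesN] still lists its register; 1 is harmless, being scratch
    space. *)
Definition Skip : cmd := Rep 0 (Do (NConst 1 0)).
Definition Block (l : seq cmd) : cmd := foldr Sq Skip l.

(** Without coin flips, programs are deterministic; without indirect register access, the registers
    written can be read off the text. *)
Definition basic (i : instr) : bool :=
  match i with
  | NConst _ _ | NAdd _ _ _ | XZero _ | XOne _ | XAdd _ _ _ | XSub _ _ _
  | XMul _ _ _ | XDiv _ _ _ | XOfNat _ _ | SetBit _ _ | GetBit _ _ | Cost _ _
  | Req _ _ | Query _ _ => true
  | _ => false
  end.

Fixpoint writesN (c : cmd) : seq nat :=
  match c with
  | Do (NConst d _) | Do (NAdd d _ _) | Do (GetBit d _) => [:: d]
  | Do _ => [::]
  | Sq c1 c2 | IfX _ _ c1 c2 => writesN c1 ++ writesN c2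
  | Rep _ c => writesN c
  | For d c => [:: 1%N, d & writesN c]
  end.

Fixpoint writesX (c : cmd) : seq nat :=
  match c with
  | Do (XZero d) | Do (XOne d) | Do (XAdd d _ _) | Do (XSub d _ _)
  | Do (XMul d _ _) | Do (XDiv d _ _) | Do (XOfNat d _) | Do (Cost d _)
  | Do (Req d _) | Do (Query d _) => [:: d]
  | Do _ => [::]
  | Sq c1 c2 | IfX _ _ c1 c2 => writesX c1 ++ writesX c2
  | Rep _ c | For _ c => writesX c
  end.

Fixpoint writesB (c : cmd) : bool :=
  match c with
  | Do (SetBit _ _) => true
  | Do _ => false
  | Sq c1 c2 | IfX _ _ c1 c2 => writesB c1 || writesB c2
  | Rep _ c | For _ c => writesB c
  end.

Fixpoint wf (c : cmd) : bool :=
  match c with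
  | Do i => basic i && (0%N \notin writesN (Do i))
  | Sq c1 c2 | IfX _ _ c1 c2 => wf c1 && wf c2
  | Rep _ c => wf c
  | For d c => [&& (1 < d)%N, d \notin writesN c & wf c]
  end.

Fixpoint csize (c : cmd) : nat :=
  match c with
  | Do _ => 1
  | Sq c1 c2 => csize c1 + csize c2
  | IfX _ _ c1 c2 => (csize c2 + csize c1).+2
  | Rep m c => m * csize c
  | For _ c => (csize c).+4
  end.

(** Jump targets are absolute, hence the start address [q]. [Rep] is unrolled, its count being a
    constant of the program. *)
Fixpoint compile (q : nat) (c : cmd) : seq instr :=
  match c with
  | Do i => [:: i]
  | Sq c1 c2 => compile q c1 ++ compile (q + csize c1)%N c2
  | IfX a a' c1 c2 =>
      let q1 := (q.+1 + csize c2).+1 in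
      XJumpLe a a' q1 :: compile q.+1 c2 ++
      Goto (q1 + csize c1)%N :: compile q1 c1
  | Rep m c => flatten [seq compile (q + j * csize c)%N c | j <- iota 0 m]
  | For d c => NConst d 0 :: compile q.+1 c ++
               [:: NConst 1 1; NAdd d d 1; NJumpLe d 0 q.+1]
  end.

Lemma size_compile c q : size (compile q c) = csize c.
Proof.
elim: c q => //= [c1 IH1 c2 IH2|a a' c1 IH1 c2 IH2|m c IH|d c IH] q.
- by rewrite size_cat IH1 IH2.
- by rewrite size_cat /= IH1 IH2 addnS.
- elim: m 0%N => //= m IHm k.
  by rewrite size_cat IH IHm mulSn.
- by rewrite size_cat /= IH addn3.
Qed.

(** * Big-step semantics and frame properties *)

Section Semantics.
Variables (R : realType) (n r : nat).
Variables (c : 'I_n -> R) (b : 'I_r -> R) (f : 'I_r -> {set 'I_n} -> R).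

Record store := Store { nval : nat -> nat; xval : nat -> R; bval : nat -> bool }.

Definition setN s d v := Store (upd (nval s) d v) (xval s) (bval s).
Definition setX s d v := Store (nval s) (upd (xval s) d v) (bval s).
Definition setB s d v := Store (nval s) (xval s) (upd (bval s) d v).

Definition buf (s : store) : {set 'I_n} := [set e : 'I_n | bval s (val e)].

Definition cost_at (k : nat) : R := if insub k is Some e then c e else 0.
Definition req_at (k : nat) : R := if insub k is Some i then b i else 0.
Definition query_at (k : nat) (S : {set 'I_n}) : R :=
  if insub k is Some i then f i S else 0.

Definition exec (i : instr) (s : store) : store :=
  match i with
  | NConst d k => setN s d k
  | NAdd d a a' => setN s d (nval s a + nval s a')%N
  | XZero d => setX s d 0
  | XOne d => setX s d 1
  | XAdd d a a' => setX s d (xval s a + xval s a')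
  | XSub d a a' => setX s d (xval s a - xval s a')
  | XMul d a a' => setX s d (xval s a * xval s a')
  | XDiv d a a' => setX s d (xval s a / xval s a')
  | XOfNat d a => setX s d (nval s a)%:R
  | SetBit p v => setB s (nval s p) (nval s v != 0%N)
  | GetBit d p => setN s d (bval s (nval s p))
  | Cost d p => setX s d (cost_at (nval s p))
  | Req d p => setX s d (req_at (nval s p))
  | Query d p => setX s d (query_at (nval s p) (buf s))
  | _ => s
  end.

Definition next_round (d j : nat) (s : store) : store :=
  setN (setN s 1 1) d j.+1.

Fixpoint ev (p : cmd) (s : store) : store :=
  match p with
  | Do i => exec i s
  | Sq p1 p2 => ev p2 (ev p1 s)
  | IfX a a' p1 p2 => if xval s a <= xval s a' then ev p1 s else ev p2 s
  | Rep m p => iter m (ev p) s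
  | For d p => foldl (fun s j => next_round d j (ev p s)) (setN s d 0) (iota 0 n.+1)
  end.

Lemma ev_For_stable (P : store -> Prop) d p s : P (setN s d 0) ->
  (forall j s', P s' -> P (next_round d j (ev p s'))) -> P (ev (For d p) s).
Proof.
rewrite /ev -/ev => P0 PS; elim: (iota 0 n.+1) (setN s d 0) P0 => //= j l IH s' Ps'.
by apply: IH; exact: PS.
Qed.

Lemma frameN p d s : d \notin writesN p -> nval (ev p s) d = nval s d.
Proof.
elim: p s => [i|p1 IH1 p2 IH2|a a' p1 IH1 p2 IH2|m p IH|d' p IH] s; rewrite /writesN -/writesN.
- by case: i => //= >; rewrite inE /upd => /negPf ->.
- by rewrite mem_cat negb_or => /andP[h1 h2]; rewrite /= IH2 // IH1.
- by rewrite mem_cat negb_or => /andP[h1 h2] /=; case: ifP => _; rewrite ?IH2 // IH1.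
- by move=> h /=; elim: m => //= m IHm; rewrite IH.
- rewrite !inE !negb_or => /and3P[/negPf d1 /negPf dd' h].
  apply: (@ev_For_stable (fun s' => nval s' d = nval s d)) => [|j s' <-]; first by rewrite /= /upd dd'.
  by rewrite /= /upd dd' d1 IH.
Qed.

Lemma wf_writesN0 p : wf p -> 0%N \notin writesN p.
Proof.
elim: p => //= [i /andP[] //|p1 IH1 p2 IH2|a a' p1 IH1 p2 IH2|d p IH].
- by move=> /andP[/IH1 h1 /IH2 h2]; rewrite mem_cat negb_or h1.
- by move=> /andP[/IH1 h1 /IH2 h2]; rewrite mem_cat negb_or h1.
- by move=> /and3P[d1 _ /IH h]; rewrite !inE !negb_or h andbT; case: (d) d1.
Qed.

Lemma ev_size p s : wf p -> nval s 0%N = n -> nval (ev p s) 0%N = n.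
Proof. by move=> /wf_writesN0 w <-; exact: frameN. Qed.

Lemma frameX p d s : d \notin writesX p -> xval (ev p s) d = xval s d.
Proof.
elim: p s => [i|p1 IH1 p2 IH2|a a' p1 IH1 p2 IH2|m p IH|d' p IH] s; rewrite /writesX -/writesX.
- by case: i => //= >; rewrite inE /upd => /negPf ->.
- by rewrite mem_cat negb_or => /andP[h1 h2]; rewrite /= IH2 // IH1.
- by rewrite mem_cat negb_or => /andP[h1 h2] /=; case: ifP => _; rewrite ?IH2 // IH1.
- by move=> h /=; elim: m => //= m IHm; rewrite IH.
- by move=> h; apply: (@ev_For_stable (fun s' => xval s' d = xval s d)) => // j s' <-; rewrite /= IH.
Qed.

Lemma frameB p s : ~~ writesB p -> bval (ev p s) = bval s.
Proof.
elim: p s => [i|p1 IH1 p2 IH2|a a' p1 IH1 p2 IH2|m p IH|d' p IH] s; rewrite /writesB -/writesB.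
- by case: i.
- by rewrite negb_or => /andP[h1 h2]; rewrite /= IH2 // IH1.
- by rewrite negb_or => /andP[h1 h2] /=; case: ifP => _; rewrite ?IH2 // IH1.
- by move=> h /=; elim: m => //= m IHm; rewrite IH.
- by move=> h; apply: (@ev_For_stable (fun s' => bval s' = bval s)) => // j s' <-; rewrite /= IH.
Qed.

Lemma ev_For (I : nat -> store -> Prop) d p s : (1 < d)%N -> d \notin writesN p ->
  I 0%N (setN s d 0) ->
  (forall j s', (j <= n)%N -> nval s' d = j -> I j s' -> I j.+1 (next_round d j (ev p s'))) ->
  I n.+1 (ev (For d p) s).
Proof.
move=> d1 dp I0 IS /=.
have H m s' k : (k + m <= n.+1)%N -> nval s' d = k -> I k s' ->
    I (k + m)%N (foldl (fun s j => next_round d j (ev p s)) s' (iota k m)).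
  elim: m s' k => [|m IH] s' k km sk Ik /=; first by rewrite addn0.
  rewrite -addSnnS; apply: IH; first by rewrite addSnnS.
    by rewrite /= /upd eqxx.
  by apply: IS => //; move: km; rewrite addnS ltnS; apply: leq_trans; exact: leq_addr.
by apply: (H n.+1 _ 0%N) => //=; rewrite /upd eqxx.
Qed.

Lemma ev_Rep (I : nat -> store -> Prop) m p s : I 0%N s ->
  (forall j s', (j < m)%N -> I j s' -> I j.+1 (ev p s')) -> I m (ev (Rep m p) s).
Proof.
move=> I0; elim: m => [|m IH] IS //=; apply: (IS) => //.
by apply: IH => j s' jm; apply: IS; rewrite ltnW.
Qed.

(** * Correctness and running time of compiled code *)

Section Adequacy.
Variables (coins : nat -> bool) (prog : seq instr).

Notation stp := (@step R n r c b f coins prog).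

Definition at_pc (s : store) (q fl : nat) : mstate R :=
  MState (nval s) (xval s) (bval s) q fl.

Definition runs (m m' : mstate R) (t : nat) : Prop :=
  exists2 k, (k <= t)%N & iter k stp m = m'.

Definition code_at (q : nat) (l : seq instr) : Prop :=
  exists pre post, prog = pre ++ l ++ post /\ size pre = q.

Lemma runs0 m : runs m m 0.
Proof. by exists 0%N. Qed.

Lemma runs_trans t1 t2 m1 m2 m3 : runs m1 m2 t1 -> runs m2 m3 t2 -> runs m1 m3 (t1 + t2).
Proof.
move=> [k1 h1 <-] [k2 h2 <-]; exists (k2 + k1)%N; last by rewrite iterD.
by rewrite addnC leq_add.
Qed.

Lemma runs_weaken t1 t2 m1 m2 : (t1 <= t2)%N -> runs m1 m2 t1 -> runs m1 m2 t2.
Proof. by move=> le [k kt <-]; exists k => //; exact: leq_trans le. Qed.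

Lemma runs_step m m' m2 t : stp m = m' -> runs m' m2 t -> runs m m2 t.+1.
Proof. by move=> <-; apply: (@runs_trans 1); exists 1%N. Qed.

Lemma code_at_cat q l1 l2 : code_at q (l1 ++ l2) ->
  code_at q l1 /\ code_at (q + size l1) l2.
Proof.
move=> [pre [post [E <-]]]; split.
  by exists pre, (l2 ++ post); rewrite E -catA.
by exists (pre ++ l1), post; rewrite E size_cat !catA.
Qed.

Lemma code_at_cons q i l : code_at q (i :: l) ->
  [/\ (size prog <= q)%N = false, nth (Goto q) prog q = i & code_at q.+1 l].
Proof.
move=> [pre [post [E <-]]]; split.
- by rewrite E size_cat /= addnS; apply/negbTE; rewrite -ltnNge ltnS leq_addr.
- by rewrite E nth_cat ltnn subnn.
- by exists (rcons pre i), post; rewrite E -cats1 size_cat addn1 -catA.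
Qed.

Lemma step_basic q l i s fl : code_at q (i :: l) -> basic i ->
  stp (at_pc s q fl) = at_pc (exec i s) q.+1 fl.
Proof.
move=> /code_at_cons[h1 h2 _]; rewrite /step /= h1 h2.
by case: i {h2} => //=.
Qed.

Lemma step_NJumpLe q l a a' t s fl : code_at q (NJumpLe a a' t :: l) ->
  stp (at_pc s q fl) = at_pc s (if (nval s a <= nval s a')%N then t else q.+1) fl.
Proof. by move=> /code_at_cons[h1 h2 _]; rewrite /step /= h1 h2. Qed.

Fixpoint time (p : cmd) : nat :=
  match p with
  | Do _ => 1
  | Sq p1 p2 => time p1 + time p2
  | IfX _ _ p1 p2 => (time p1 + time p2).+2
  | Rep m p => m * time p
  | For _ p => (n.+1 * (time p).+3).+1
  end.

Lemma compile_correct p q s fl : wf p -> nval s 0%N = n ->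
  code_at q (compile q p) ->
  runs (at_pc s q fl) (at_pc (ev p s) (q + csize p) fl) (time p).
Proof.
elim: p q s => [i|p1 IH1 p2 IH2|a a' p1 IH1 p2 IH2|m p IH|d p IH] q s /=.
- move=> /andP[bi _] _ /step_basic h; rewrite addn1.
  by apply: runs_step (h _ _ bi) _; exact: runs0.
- move=> /andP[w1 w2] s0 /code_at_cat[]; rewrite size_compile => c1 c2.
  apply: runs_trans (IH1 _ _ w1 s0 c1) _; rewrite addnA; apply: IH2 => //.
  exact: ev_size.
- move=> /andP[w1 w2] s0 /code_at_cons[h1 h2 /code_at_cat[c2]].
  rewrite size_compile => /code_at_cons[g1 g2 c1].
  case: ifP => le.
    apply: (@runs_step _ (at_pc s (q.+1 + csize p2).+1 fl)).
      by rewrite /step /= h1 h2 /= le.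
    have := IH1 _ _ w1 s0 c1.
    have -> : ((q.+1 + csize p2).+1 + csize p1 = q + (csize p2 + csize p1).+2)%N by lia.
    by apply: runs_weaken; lia.
  apply: (@runs_step _ (at_pc s q.+1 fl)); first by rewrite /step /= h1 h2 /= le.
  apply: (@runs_weaken (time p2 + 1)); first by lia.
  apply: runs_trans (IH2 _ _ w2 s0 c2) _.
  apply: runs_step (runs0 _).
  by rewrite /step /= g1 g2 /at_pc; congr (MState _ _ _ _ _); lia.
- move=> w s0 cm.
  have H k l s' : nval s' 0%N = n ->
      code_at (q + k * csize p) (flatten [seq compile (q + j * csize p) p | j <- iota k l]) ->
      runs (at_pc s' (q + k * csize p) fl)
           (at_pc (iter l (ev p) s') (q + (k + l) * csize p) fl) (l * time p).
    elim: l k s' => [|l IHl] k s' s0'; first by rewrite addn0 => _; exact: runs0.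
    move=> /= /code_at_cat[]; rewrite size_compile => ck cl.
    rewrite -/(iter l.+1 (ev p) s') iterSr mulSn; apply: runs_trans (IH _ _ w s0' ck) _.
    rewrite -addnA -mulSnr -addSnnS; apply: IHl; first exact: ev_size.
    by rewrite mulSnr addnA.
  by have := H 0%N m s s0; rewrite mul0n addn0 add0n; apply.
- move=> /and3P[d1 dp w] s0 /code_at_cons[h1 h2 /code_at_cat[cp]].
  rewrite size_compile => /code_at_cons[g1 g2] /code_at_cons[g3 g4] /step_NJumpLe jmp.
  apply: (@runs_step _ (at_pc (setN s d 0) q.+1 fl)); first by rewrite /step /= h1 h2.
  have d0 : (0%N == d) = false by case: (d) d1.
  (* [k] counts the rounds left after the current one; for [k = 0] the counter becomes n + 1 and the
     backward jump is not taken. *)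
  have H k j s' : (j + k)%N = n -> nval s' 0%N = n -> nval s' d = j ->
      runs (at_pc s' q.+1 fl)
        (at_pc (foldl (fun s j => next_round d j (ev p s)) s' (iota j k.+1)) (q + (csize p).+4) fl)
        (k.+1 * (time p).+3).
    elim: k j s' => [|k IHk] j s' jk s0' sd; rewrite mulSn 3!addSnnS;
      apply: runs_trans (IH _ _ w s0' cp) _;
      (apply: (@runs_step _ (at_pc (setN (ev p s') 1 1) (q.+1 + csize p).+1 fl));
        first by rewrite /step /= g1 g2);
      (apply: (@runs_step _ (at_pc (next_round d j (ev p s')) (q.+1 + csize p).+2 fl));
        first by rewrite /step /= g3 g4 /next_round /setN /at_pc /= /upd /= [d == 1%N]gtn_eqF // frameN // sd addn1);
      (have nd : nval (next_round d j (ev p s')) d = j.+1 by rewrite /= /upd eqxx);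
      (have n0 : nval (next_round d j (ev p s')) 0%N = n by rewrite /= /upd d0 ev_size).
    - apply: runs_step (runs0 _); rewrite jmp nd n0 -jk addn0 ltnn.
      by rewrite /at_pc /=; congr (MState _ _ _ _ _); lia.
    - apply: (@runs_step _ (at_pc (next_round d j (ev p s')) q.+1 fl)).
        by rewrite jmp nd n0 -jk addnS ltnS leq_addr.
      by apply: IHk => //; rewrite addSnnS.
  apply: H => //; rewrite /= /upd ?eqxx //.
  by rewrite d0.
Qed.
End Adequacy.

Definition init_store : store :=
  Store (upd (upd (fun _ => 0%N) 0 n) 1 r) (fun _ => 0) (fun _ => false).

(** A halted state is a fixed point of [step], so any time budget beyond [time p] gives the same
    output, whatever the coins. *)
Lemma run_compile p coins T : wf p -> (time p <= T)%N ->
  let m := run c b f coins (compile 0 p) T in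
  halted (compile 0 p) m /\ bufset n m = buf (ev p init_store).
Proof.
move=> w pT m.
have code0 : code_at (compile 0 p) 0 (compile 0 p).
  by exists [::], [::]; rewrite cats0.
have [k kp kE] := compile_correct coins _ p 0 init_store 0 w erefl code0.
have -> : m = at_pc (ev p init_store) (csize p) 0.
  rewrite /m /run -(subnK (leq_trans kp pT)) iterD [iter k _ _]kE.
  elim: (T - k)%N => //= l ->.
  by rewrite /step /= size_compile leqnn.
by rewrite /halted /= size_compile leqnn.
Qed.

End Semantics.

Arguments nval {R} s.
Arguments xval {R} s.
Arguments bval {R} s.

(** Each [For] costs one factor n + 1, and the number of loops is fixed by the program. *)
Lemma time_poly p : exists C k, forall n, (time n p <= C * n.+1 ^ k)%N.
Proof.
have grow n k l : (n.+1 ^ k <= n.+1 ^ (k + l))%N by rewrite leq_pexp2l // leq_addr.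
elim: p => [i|p1 [C1 [k1 h1]] p2 [C2 [k2 h2]]|a a' p1 [C1 [k1 h1]] p2 [C2 [k2 h2]]
           |m p [C [k h]]|d p [C [k h]]] /=.
- by exists 1%N, 0%N.
- exists (C1 + C2)%N, (k1 + k2)%N => n; rewrite mulnDl leq_add //.
    by apply: (leq_trans (h1 n)); rewrite leq_mul2l grow orbT.
  by apply: (leq_trans (h2 n)); rewrite leq_mul2l addnC grow orbT.
- exists (C1 + C2 + 2)%N, (k1 + k2)%N => n; rewrite -addn2 !mulnDl !leq_add //.
  + by apply: (leq_trans (h1 n)); rewrite leq_mul2l grow orbT.
  + by apply: (leq_trans (h2 n)); rewrite leq_mul2l addnC grow orbT.
  + by rewrite leq_pmulr // expn_gt0.
- by exists (m * C)%N, k => n; rewrite -mulnA leq_mul2l h orbT.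
- exists (C + 4)%N, k.+1 => n; have := h n.
  have : (0 < n.+1 ^ k)%N by rewrite expn_gt0.
  rewrite expnS; move: (time n p) (n.+1 ^ k)%N => t z z0 tz.
  apply: (@leq_trans (n.+1 * (C * z + 3 * z)).+1); last by nia.
  by rewrite ltnS leq_mul2l -addn3 leq_add //; lia.
Qed.

(** * The algorithm *)

(* The current set lives in the bits [0..n], where bit [n] belongs to no element
   and absorbs dummy choices; the best relaxed-feasible set found so far lives in
   the bits [n+1..2n+1] and its cost in [X[0]].  [X[1]] is the cost of the current
   set, [X[2]] that of the guess. *)

Definition sum_cost : cmd := Block [:: Do (XZero 1);
  For 2 (Block [:: Do (GetBit 6 2); Do (XOfNat 3 6); Do (Cost 4 2);
                   Do (XMul 3 3 4); Do (XAdd 1 1 3)])].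

(** The result is left in [X[6]]. By convention [X[14]] is 0, for comparing and copying, and [N[10]]
    is 1; the test truncates the deficit at 0. *)
Definition pot_code (r p : nat) : cmd := Block [:: Do (XZero 6); Do (XZero 14);
  Do (NConst 10 1); Do (NConst 4 0);
  Rep r (Block [:: Do (Query 3 4); Do (Req 4 4); Do (XSub 3 4 3);
    IfX 14 3 Skip (Do (XZero 3)); Do (XDiv 3 3 4); Do (XOne 5);
    Rep p (Do (XMul 5 5 3)); Do (XAdd 6 6 5); Do (NAdd 4 4 10)])].

(* Sets [X[10]] to 0 exactly if the current set is relaxed-feasible for the
   ratio [u / v]. *)
Definition check_code (r u v : nat) : cmd := Block [:: Do (XZero 10); Do (XZero 14);
  Do (NConst 10 1); Do (NConst 4 0); Do (NConst 7 u); Do (XOfNat 12 7);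
  Do (NConst 7 v); Do (XOfNat 15 7); Do (XDiv 12 12 15);
  Rep r (Block [:: Do (Query 3 4); Do (Req 4 4); Do (XMul 4 12 4);
    IfX 4 3 Skip (Do (XOne 10)); Do (NAdd 4 4 10)])].

Definition save_code : cmd := Block [:: Do (XZero 14); Do (XAdd 0 1 14);
  Do (NConst 7 1); Do (NAdd 7 7 0);
  For 2 (Block [:: Do (GetBit 6 2); Do (NAdd 5 2 7); Do (SetBit 5 6)])].

Definition record_code (r u v : nat) : cmd := Block [:: check_code r u v;
  IfX 10 14 (IfX 0 1 Skip save_code) Skip].

(** [X[8]] and [X[9]] hold the gain and cost of the best choice [N[8]]. Ratios are compared by
    cross-multiplication, since costs may be 0; each trial insertion is undone from the bit saved in
    [N[9]]. *)
Definition select_code (r p K : nat) : cmd := Block [:: pot_code r p;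
  Do (XAdd 7 6 14); Do (NConst 8 0); Do (NAdd 8 8 0); Do (XZero 8); Do (XOne 9);
  Do (NConst 7 K); Do (XOfNat 16 7);
  For 2 (Block [:: Do (Cost 11 2); Do (XMul 13 16 11);
    IfX 13 2
      (Block [:: Do (GetBit 9 2); Do (NConst 10 1); Do (SetBit 2 10); pot_code r p;
        Do (SetBit 2 9); Do (XSub 13 7 6); Do (XMul 15 13 9); Do (XMul 3 8 11);
        IfX 15 3 Skip
          (Block [:: Do (NConst 8 0); Do (NAdd 8 8 2); Do (XAdd 8 13 14);
                     Do (XAdd 9 11 14)])])
      Skip])].

Definition step_code (r p K : nat) : cmd :=
  Block [:: select_code r p K; Do (NConst 10 1); Do (SetBit 8 10)].

Definition clear_code : cmd := Block [:: Do (NConst 6 0); For 2 (Do (SetBit 2 6))].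

Definition load_code (m : nat) : cmd :=
  Block (Do (NConst 10 1) :: [seq Do (SetBit (20 + j) 10) | j <- iota 0 m]).

Definition inner_code (r u v p K m : nat) : cmd := Block [:: clear_code; load_code m;
  sum_cost; Do (XZero 14); Do (XAdd 2 1 14); record_code r u v;
  For 3 (Block [:: step_code r p K; sum_cost; record_code r u v])].

(** Nested loops enumerate all tuples; the counters lie above every register that the body
    writes. *)
Fixpoint guess_code (l : nat) (body : cmd) : cmd :=
  if l is l'.+1 then For (20 + l') (guess_code l' body) else body.

(** The whole ground set is recorded first, so that the record is relaxed-feasible from the
    start. *)
Definition init_code : cmd := Block [:: Do (NConst 10 1); For 2 (Do (SetBit 2 10));
  sum_cost; save_code].

Definition final_code : cmd := Block [:: Do (NConst 7 1); Do (NAdd 7 7 0);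
  For 2 (Block [:: Do (NAdd 5 2 7); Do (GetBit 6 5); Do (SetBit 2 6)])].

Definition main_code (r u v p K m : nat) : cmd :=
  Block [:: init_code; guess_code m (inner_code r u v p K m); final_code].

Arguments ev : simpl never.
Local Arguments upd {T} g j v i /.

(** * Correctness of the program fragments *)

Section Specifications.
Variables (R : realType) (n r : nat).
Variables (c : 'I_n -> R) (b : 'I_r -> R) (f : 'I_r -> {set 'I_n} -> R).

Notation store := (store R).
Notation ev := (@ev R n r c b f).
Notation buf := (@buf R n).
Notation exec := (@exec R n r c b f).
Notation cost_at := (@cost_at R n c).
Notation req_at := (@req_at R r b).
Notation query_at := (@query_at R n r f).
Notation cost := (set_cost c).

Lemma ev_cons p l s : ev (Block (p :: l)) s = ev (Block l) (ev p s).
Proof. by []. Qed.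

Lemma ev_nil s : ev (Block [::]) s = s. Proof. by []. Qed.

Lemma ev_Skip s : ev Skip s = s. Proof. by []. Qed.

Lemma ev_Do i s : ev (Do i) s = exec i s. Proof. by []. Qed.

Lemma ev_IfX a a' p1 p2 s :
  ev (IfX a a' p1 p2) s = if xval s a <= xval s a' then ev p1 s else ev p2 s.
Proof. by []. Qed.

Definition evE := (ev_cons, ev_nil, ev_Do, ev_Skip).

Lemma buf_eq (s s' : store) :
  (forall k, (k <= n)%N -> bval s k = bval s' k) -> buf s = buf s'.
Proof. by move=> h; apply/setP => e; rewrite !inE h //; exact: ltnW (ltn_ord e). Qed.

Lemma cost_at_ord (e : 'I_n) : cost_at e = c e.
Proof. by rewrite /cost_at valK. Qed.

Lemma req_at_ord (i : 'I_r) : req_at i = b i.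
Proof. by rewrite /req_at valK. Qed.

Lemma query_at_ord (i : 'I_r) S : query_at i S = f i S.
Proof. by rewrite /query_at valK. Qed.

Lemma cost_at_n : cost_at n = 0.
Proof. by rewrite /cost_at insubF // ltnn. Qed.

Lemma sum_costE s : xval (ev sum_cost s) 1 = cost (buf s).
Proof.
have -> : cost (buf s) = \sum_(0 <= k < n.+1) (bval s k)%:R * cost_at k.
  rewrite big_nat_recr //= cost_at_n mulr0 addr0 big_mkord /set_cost big_mkcond.
  by apply: eq_bigr => e _; rewrite inE cost_at_ord; case: (bval s e); rewrite ?mul1r ?mul0r.
rewrite /sum_cost !evE.
pose I j (s' : store) := bval s' = bval s /\
  xval s' 1 = \sum_(0 <= k < j) (bval s k)%:R * cost_at k.
suff [] : I n.+1 (ev (For 2 (Block [:: Do (GetBit 6 2); Do (XOfNat 3 6); Do (Cost 4 2);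
                   Do (XMul 3 3 4); Do (XAdd 1 1 3)])) (exec (XZero 1) s)) by [].
apply: (@ev_For R n r c b f I) => //; first by split=> //=; rewrite big_nil.
move=> j s' jn sj [h1 h2]; split; rewrite !evE //=.
by rewrite big_nat_recr //= h2 h1 sj.
Qed.

Lemma ev_pow p s : let s' := ev (Rep p (Do (XMul 5 5 3))) s in
  [/\ bval s' = bval s, nval s' = nval s, (forall d, d != 5%N -> xval s' d = xval s d) &
      xval s' 5 = xval s 5 * xval s 3 ^+ p].
Proof.
apply: (@ev_Rep R n r c b f (fun j s' => [/\ bval s' = bval s, nval s' = nval s,
  (forall d, d != 5%N -> xval s' d = xval s d) & xval s' 5 = xval s 5 * xval s 3 ^+ j])).
  by split=> //; rewrite mulr1.
move=> j s' _ [h1 h2 h3 h4]; rewrite evE; split=> //=.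
  by move=> d d5; rewrite (negPf d5) h3.
by rewrite h4 h3 // exprSr mulrA.
Qed.

Lemma pot_codeE p s : xval (ev (pot_code r p) s) 6 = potential R n r b f p (buf s) /\
  xval (ev (pot_code r p) s) 14 = 0.
Proof.
rewrite /pot_code !evE.
set s1 := exec (NConst 4 0) _.
pose F k : R := (Num.max 0 (req_at k - query_at k (buf s)) / req_at k) ^+ p.
pose I j (s' : store) := [/\ bval s' = bval s, nval s' 4 = j, nval s' 10 = 1%N, xval s' 14 = 0 &
  xval s' 6 = \sum_(0 <= k < j) F k].
have -> : potential R n r b f p (buf s) = \sum_(0 <= k < r) F k.
  rewrite big_mkord; apply: eq_bigr => i _.
  by rewrite /deficit /F req_at_ord query_at_ord.
set Q := Rep r _.
suff [] : I r (ev Q s1) by [].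
apply: (@ev_Rep R n r c b f I); first by split=> //=; rewrite big_nil.
move=> j s' jr [h1 h2 h3 h4 h5]; rewrite !evE.
set s2 := exec (XSub 3 4 3) _.
rewrite ev_IfX ev_Skip ev_Do.
set s3 := (X in exec (XDiv 3 3 4) X).
have [e1 e2 e3 e4 [e5 e6]] : [/\ bval s3 = bval s, nval s3 = nval s', xval s3 14 = 0,
    xval s3 4 = req_at j & xval s3 6 = xval s' 6 /\
    xval s3 3 = Num.max 0 (req_at j - query_at j (buf s))].
  have bE : buf s' = buf s by apply: buf_eq => k _; rewrite h1.
  have x14 : xval s2 14 = 0 by [].
  have x3 : xval s2 3 = req_at j - query_at j (buf s) by rewrite -bE -h2.
  rewrite /s3 x14 x3 maxEle; case: ifP => _; first by rewrite x3 /= h2.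
  by rewrite /= h2.
set s4 := exec (XOne 5) _.
have [g1 g2 g3 g4] := ev_pow p s4.
split; rewrite /= ?g1 ?g2 ?g4 ?g3 //=.
- by rewrite e2 h2 h3 addn1.
- by rewrite e2.
- by rewrite /s4 /= big_nat_recr //= e5 e6 h5 e4 mul1r.
Qed.
Lemma check_codeE u v s (s' := ev (check_code r u v) s) :
  (xval s' 10 <= 0) = relaxed R n r b f (u%:R / v%:R) (buf s) /\ xval s' 14 = 0.
Proof.
rewrite /s' /check_code !evE.
set s1 := exec (XDiv 12 12 15) _.
pose P k := u%:R / v%:R * req_at k <= query_at k (buf s).
pose I j (s' : store) := [/\ bval s' = bval s, nval s' 4 = j, nval s' 10 = 1%N, xval s' 14 = 0 &
  xval s' 12 = u%:R / v%:R /\ (xval s' 10 <= 0 <-> forall k, (k < j)%N -> P k)].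
set Q := Rep r _.
have [_ _ _ -> [_ h]] : I r (ev Q s1).
  apply: (@ev_Rep R n r c b f I).
    by split=> //=; split=> //; rewrite lexx.
  move=> j s2 jr [h1 h2 h3 h4 [h5 h6]]; rewrite !evE ev_IfX ev_Skip evE.
  have bE : buf s2 = buf s by apply: buf_eq => k _; rewrite h1.
  rewrite [X in if X then _ else _](_ : _ = P j); last by rewrite /= h2 h5 bE.
  case: ifP => Pj; split; rewrite /= ?h2 ?h3 ?addn1 //; split=> //.
    rewrite h6; split=> H k; last by move=> kj; apply: H; exact: leqW.
    by rewrite ltnS leq_eqVlt => /orP[/eqP ->|/H].
  split=> [|/(_ j (ltnSn _))]; last by rewrite Pj.
  by rewrite ler10.
split=> //; apply/idP/forallP.
  by move=> /h H i; have := H i (ltn_ord i); rewrite /P req_at_ord query_at_ord.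
move=> H; apply/h => k kr; rewrite /P -[k]/(val (Ordinal kr)).
by rewrite req_at_ord query_at_ord; exact: H.
Qed.

Definition best (s : store) : {set 'I_n} := [set e : 'I_n | bval s (e + n.+1)%N].

Lemma save_codeE s (s' := ev save_code s) : nval s 0 = n ->
  [/\ forall k, (k <= n)%N -> bval s' k = bval s k, best s' = buf s & xval s' 0 = xval s 1].
Proof.
move=> s0; rewrite /s' /save_code !evE.
set s1 := exec (NAdd 7 7 0) _.
have [h1 h2 h3 h4] : [/\ bval s1 = bval s, nval s1 0 = n, nval s1 7 = n.+1 & xval s1 0 = xval s 1].
  by rewrite /= addr0 s0 add1n.
pose I j (s' : store) := [/\ nval s' 7 = n.+1, xval s' 0 = xval s 1,
  forall k, (k <= n)%N -> bval s' k = bval s k &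
  forall k, (k < j)%N -> bval s' (k + n.+1)%N = bval s k].
set Q := For 2 _.
have [_ h5 h6 h7] : I n.+1 (ev Q s1).
  apply: (@ev_For R n r c b f I) => //.
  move=> j s2 jn sj [g1 g2 g3 g4]; rewrite !evE; split=> //=.
    by move=> k kn; rewrite g1 sj ltn_eqF ?g3 //; lia.
  move=> k kj; rewrite g1 sj eqn_add2r; case: eqP => [->|kj'].
    by rewrite g3 //; case: (bval s j).
  by apply: g4; lia.
split=> //; apply/setP => e; rewrite !inE h7 //; exact: ltnW (ltn_ord e).
Qed.

Definition record_inv u v (s : store) : Prop :=
  [/\ nval s 0 = n, relaxed R n r b f (u%:R / v%:R) (best s) & xval s 0 = cost (best s)].

Lemma best_bval (s s' : store) : bval s = bval s' -> best s = best s'.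
Proof. by rewrite /best => ->. Qed.

Lemma record_codeE u v s (s' := ev (record_code r u v) s) :
  record_inv u v s -> xval s 1 = cost (buf s) ->
  [/\ record_inv u v s', buf s' = buf s, xval s' 0 <= xval s 0, xval s' 2 = xval s 2 &
      relaxed R n r b f (u%:R / v%:R) (buf s) -> xval s' 0 <= cost (buf s)].
Proof.
move=> [s0 sr sb] s1; rewrite /s' /record_code !evE ev_IfX.
have [] := check_codeE u v s; set s2 := ev (check_code _ _ _) s => h1 h2.
have b2 : bval s2 = bval s by apply: frameB.
have n2 : nval s2 0 = n by rewrite -s0; apply: frameN.
have x0 : xval s2 0 = xval s 0 by apply: frameX.
have x1 : xval s2 1 = xval s 1 by apply: frameX.
have x2 : xval s2 2 = xval s 2 by apply: frameX.
have buf2 : buf s2 = buf s by apply: buf_eq => k _; rewrite b2.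
have inv2 : record_inv u v s2 by rewrite /record_inv n2 x0 (best_bval s2 s).
rewrite h2 h1; case: ifP => rel; last by rewrite ev_Skip x0 x2.
rewrite ev_IfX ev_Skip x0 x1; case: ifP => le; first by rewrite x0 x2 -s1.
have [g1 g2 g3] := save_codeE s2 n2; set s3 := ev save_code s2 in g1 g2 g3 *.
have n3 : nval s3 0 = n by rewrite -n2; apply: frameN.
have y2 : xval s3 2 = xval s 2 by rewrite -x2; apply: frameX.
rewrite g3 x1 s1; split=> //.
- by split=> //; rewrite g2 buf2 // g3 x1.
- by rewrite -buf2; apply: buf_eq => k kn; rewrite g1.
- by rewrite -s1 ltW // ltNge le.
Qed.

Lemma buf_setB (s : store) (e : 'I_n) : buf (setB R s e true) = e |: buf s.
Proof. by apply/setP => x; rewrite !inE /= -val_eqE; case: eqP. Qed.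

Hypothesis inst : msc_instance c b f.

Lemma step_codeE q K s (s' := ev (step_code r q.+1 K) s) : nval s 0 = n ->
  greedy_choice R n r c b f q K (xval s 2) (buf s) (buf s') /\
  (forall k, (n < k)%N -> bval s' k = bval s k).
Proof.
move=> s0; rewrite /s' /step_code /select_code !evE.
set body := IfX 13 2 _ _.
set s1 := exec (XOfNat 16 7) _.
set Q := For 2 _.
pose S := buf s; pose cA := xval s 2; pose gainS := gain R n r b f q S.
(* The stored pair beats every cheap element below [j], and is either that of a real element or the
   initial dummy. *)
pose I j (t : store) := [/\ forall k, bval t k = bval s k, nval t 0 = n,
  [/\ xval t 7 = potential R n r b f q.+1 S, xval t 2 = cA, xval t 16 = K%:R & xval t 14 = 0],
  [/\ 0 <= xval t 8, 0 <= xval t 9 & forall e : 'I_n, (e < j)%N -> K%:R * c e <= cA ->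
     gainS e * xval t 9 <= xval t 8 * c e] &
  (exists e : 'I_n, [/\ nval t 8 = e, K%:R * c e <= cA, 0 < xval t 8,
     xval t 8 = gainS e & xval t 9 = c e])
  \/ [/\ nval t 8 = n, xval t 8 = 0 & xval t 9 = 1]].
suff [h1 h2 _ [h3 h4 h5] h6] : I n.+1 (ev Q s1).
  split; last by move=> k nk /=; case: h6 => [[e [-> _ _ _ _]]|[-> _ _]];
    rewrite ?h1 gtn_eqF //; apply: ltn_trans nk.
  exists (xval (ev Q s1) 8), (xval (ev Q s1) 9); split.
    by move=> e; apply: h5; exact: ltnW (ltn_ord e).
  have bE : buf (ev Q s1) = S by apply: buf_eq => k _.
  case: h6 => [[e [e1 e2 e3 e4 e5]]|[e1 e2 e3]]; [left|right].
    exists e; split=> //.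
    by rewrite -/S -bE -buf_setB; apply: buf_eq => k _; rewrite /= e1.
  split=> //; rewrite -/S -bE; apply/setP => e; rewrite !inE /= e1.
  by rewrite ltn_eqF // ltn_ord.
have [p1 p2] := pot_codeE q.+1 s.
have n0 : nval (ev (pot_code r q.+1) s) 0 = n by rewrite frameN.
have y2 : xval (ev (pot_code r q.+1) s) 2 = cA by apply: frameX.
have b0 : bval (ev (pot_code r q.+1) s) = bval s by apply: frameB.
apply: (@ev_For R n r c b f I) => //.
  split=> //=; first by rewrite b0.
  - by rewrite p1 p2 addr0.
  - by right; rewrite n0.
move=> j t jn tj [t1 t2 [t3 t4 t5 t6] [t7 t8 t9] t10]; rewrite !evE.
set t' := exec (XMul 13 16 11) _.
have tc : xval t' 11 = cost_at j by rewrite /= tj.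
have cond : (xval t' 13 <= xval t' 2) = (K%:R * cost_at j <= cA).
  by rewrite /= tj t5 t4.
rewrite /body ev_IfX cond ev_Skip; case: ifP => cj; last first.
  split=> //; split=> // e; rewrite ltnS leq_eqVlt => /orP[/eqP ej|]; last exact: t9.
  by rewrite -cost_at_ord ej cj.
rewrite !evE.
set w1 := exec (SetBit 2 10) _; set w2 := ev (pot_code r q.+1) w1.
have [q1 q2] := pot_codeE q.+1 w1.
have m0 : nval w2 0 = n by rewrite -t2; apply: frameN.
have m2 : nval w2 2 = j by rewrite -tj; apply: frameN.
have m9 : nval w2 9 = bval s j by rewrite -t1 -tj; apply: frameN.
have m8 : nval w2 8 = nval t 8 by apply: frameN.
have z2 : xval w2 2 = cA by rewrite -t4; apply: frameX.
have z7 : xval w2 7 = potential R n r b f q.+1 S by rewrite -t3; apply: frameX.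
have z16 : xval w2 16 = K%:R by rewrite -t5; apply: frameX.
have z8 : xval w2 8 = xval t 8 by apply: frameX.
have z9 : xval w2 9 = xval t 9 by apply: frameX.
have z11 : xval w2 11 = cost_at j by rewrite -tc; apply: frameX.
have bw : bval w2 = bval w1 by apply: frameB.
pose g := potential R n r b f q.+1 S - potential R n r b f q.+1 (buf w1).
set w3 := exec (XMul 3 8 11) _.
have b3 k : bval w3 k = bval s k.
  rewrite /= m2 m9 bw; case: eqP => [->|kj]; first by case: (bval s j).
  by rewrite /= tj t1; case: eqP kj.
have x13 : xval w3 13 = g by rewrite /= z7 q1.
have cond2 : (xval w3 15 <= xval w3 3) = (g * xval t 9 <= xval t 8 * cost_at j).
  by rewrite /= z7 q1 z8 z9 z11.
have new (e : 'I_n) : val e = j -> g = gainS e.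
  move=> ej; rewrite /g /gainS /gain; congr (_ - potential _ _ _ _ _ _ _).
  have -> : S = buf t by apply: buf_eq => k _; rewrite t1.
  by rewrite -buf_setB; apply: buf_eq => k _; rewrite /= tj -ej.
rewrite ev_IfX cond2 ev_Skip; case: ifP => better.
  split=> //; rewrite /= ?m0 ?z2 ?z7 ?z16 ?z8 ?z9 ?m8 //.
  split=> // e; rewrite ltnS leq_eqVlt => /orP[/eqP ej _|]; last exact: t9.
  by rewrite -(new e ej) -cost_at_ord ej.
have lt : xval t 8 * cost_at j < g * xval t 9 by rewrite ltNge better.
(* Position n has gain 0 and cost 0, so it never wins the strict comparison. *)
have jlt : (j < n)%N.
  rewrite ltn_neqAle jn andbT; apply/eqP => jE; move: lt.
  have -> : g = 0.
    apply/eqP; rewrite subr_eq0; apply/eqP; congr potential.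
    apply/setP => e; rewrite !inE /= tj t1 jE ltn_eqF //; exact: ltn_ord.
  by rewrite jE cost_at_n mulr0 mul0r ltxx.
have [e ej] : exists e : 'I_n, val e = j by exists (Ordinal jlt).
have cE : cost_at j = c e by rewrite -ej cost_at_ord.
have ce : 0 <= c e by case: inst.
rewrite cE in lt.
have g0 : 0 < g.
  rewrite ltNge; apply/negP => g0; move: lt; rewrite ltNge.
  by rewrite (le_trans (mulr_le0_ge0 g0 t8)) ?mulr_ge0.
(* A stored element of cost 0 is never displaced; the positive denominator makes the
   cross-multiplied comparison transitive. *)
have k0 : 0 < xval t 9.
  rewrite lt_def t8 andbT; apply/eqP => k0; move: lt.
  by rewrite k0 mulr0 ltNge mulr_ge0.
rewrite !evE; split; first exact: b3.
all: rewrite /= ?m2 ?m0 ?z2 ?z7 ?z16 ?q2 ?z11 ?q1 ?addr0 -/g ?cE //.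
- split=> //; first exact: ltW.
  move=> x; rewrite ltnS leq_eqVlt => /orP[/eqP xj|xj] xK.
    by rewrite -(new x xj) -cE -xj cost_at_ord.
  have h := t9 x xj xK; have cx : 0 <= c x by case: inst.
  rewrite -(ler_pM2r k0); apply: (@le_trans _ _ (xval t 8 * c x * c e)).
    by rewrite mulrAC ler_wpM2r.
  by rewrite mulrAC [leRHS]mulrAC ler_wpM2r // ltW.
- by left; exists e; split=> //; rewrite -?(new e ej) // -cE.
Qed.

Lemma clear_codeE s (s' := ev clear_code s) :
  (forall k, (k <= n)%N -> bval s' k = false) /\
  (forall k, (n < k)%N -> bval s' k = bval s k).
Proof.
rewrite /s' /clear_code !evE; set s1 := exec (NConst 6 0) s; set Q := For 2 _.
pose I j (t : store) := [/\ nval t 6 = 0, forall k, (k < j)%N -> bval t k = false &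
  forall k, (n < k)%N -> bval t k = bval s k].
suff [_ h1 h2] : I n.+1 (ev Q s1) by split=> // k kn; apply: h1.
apply: (@ev_For R n r c b f I) => // j t jn tj [t6 h1 h2]; rewrite !evE; split=> //= k kj.
  by rewrite tj t6; case: eqP => // kj'; apply: h1; lia.
by rewrite tj gtn_eqF ?h2 //; lia.
Qed.

Lemma load_codeE m s (s' := ev (load_code m) s) :
  [/\ xval s' = xval s, (forall d, d != 10 -> nval s' d = nval s d) &
      forall k, bval s' k = bval s k || (k \in [seq nval s (20 + j) | j <- iota 0 m])].
Proof.
rewrite /s' /load_code ev_cons ev_Do; set s1 := exec _ s.
have H L t : nval t 10 = 1 -> let t' := ev (Block [seq Do (SetBit (20 + j) 10) | j <- L]) t in
    [/\ xval t' = xval t, nval t' = nval t &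
      forall k, bval t' k = bval t k || (k \in [seq nval t (20 + j) | j <- L])].
  elim: L t => [|j L IH] t t10; first by split=> // k; rewrite in_nil orbF.
  rewrite map_cons ev_cons ev_Do; have [//|h1 h2 h3] := IH (exec (SetBit (20 + j) 10) t).
  split=> // k; rewrite h3 /= t10 in_cons; case: eqP => //= _; first by rewrite orbT.
have [//|-> h2 h3] := H (iota 0 m) s1.
by split=> // d d10; rewrite h2 /= (negPf d10).
Qed.

Lemma best_eq (s s' : store) :
  (forall k, (n < k)%N -> bval s' k = bval s k) -> best s' = best s.
Proof. by move=> h; apply/setP => e; rewrite !inE h // ltn_addl. Qed.

Lemma record_inv_frame u v (s s' : store) : nval s' 0 = nval s 0 -> xval s' 0 = xval s 0 ->
  (forall k, (n < k)%N -> bval s' k = bval s k) -> record_inv u v s -> record_inv u v s'.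
Proof. by rewrite /record_inv => -> -> /best_eq ->. Qed.

(* Abstracts what the analysis of the greedy phase from the guess [A] provides. *)
Definition greedy_run (u v q K : nat) (A : {set 'I_n}) (V : R)
    (I : nat -> {set 'I_n} -> Prop) : Prop :=
  let rel := relaxed R n r b f (u%:R / v%:R) in
  [/\ rel A -> cost A <= V, ~~ rel A -> I 0 A, forall t S, I t S -> (t <= n)%N &
      forall t S S', I t S -> greedy_choice R n r c b f q K (cost A) S S' ->
        cost S' <= V /\ (rel S' \/ I t.+1 S')].

Lemma inner_codeE u v q K m s (s' := ev (inner_code r u v q.+1 K m) s) :
  record_inv u v s -> (forall j, (j < m)%N -> (nval s (20 + j) <= n)%N) ->
  [/\ record_inv u v s', xval s' 0 <= xval s 0 & forall A V I,
     A = [set e : 'I_n | val e \in [seq nval s (20 + j) | j <- iota 0 m]] ->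
     greedy_run u v q K A V I -> xval s' 0 <= V].
Proof.
move=> inv regs; rewrite /s' /inner_code 3!ev_cons; set A0 := [set e | _].
have [c1 c2] := clear_codeE s; set s1 := ev clear_code s in c1 c2 *.
have N1 d : d \notin [:: 1; 2; 6] -> nval s1 d = nval s d.
  by move=> h; apply: frameN; move: h; rewrite /= !inE; do !case: eqP.
have R1 : [seq nval s1 (20 + j) | j <- iota 0 m] = [seq nval s (20 + j) | j <- iota 0 m].
  by apply: eq_map => j; apply: N1.
have X1 : xval s1 0 = xval s 0 by apply: frameX.
have [l1 l2 l3] := load_codeE m s1; set s2 := ev (load_code m) s1 in l1 l2 l3 *.
rewrite R1 in l3.
(* Guess registers are at most n, so loading leaves the saved set alone. *)
have B2 k : (n < k)%N -> bval s2 k = bval s k.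
  move=> nk; rewrite l3 c2 // orbC; case: mapP => // -[j].
  by rewrite mem_iota /= add0n => /regs jn kE; move: nk; rewrite kE ltnNge jn.
have bufA : buf s2 = A0.
  by apply/setP => e; rewrite !inE l3 c1 //; exact: ltnW (ltn_ord e).
have x3 := sum_costE s2; rewrite bufA in x3.
rewrite ev_cons ev_Do ev_cons ev_Do ev_cons; set s3 := exec (XAdd 2 1 14) _.
have b3 : bval s3 = bval s2 by rewrite -[LHS]/(bval (ev sum_cost s2)); apply: frameB.
have buf3 : buf s3 = A0 by rewrite -bufA; apply: buf_eq => k _; rewrite b3.
have inv3 : record_inv u v s3.
  apply: record_inv_frame inv.
  - rewrite -[LHS]/(nval (ev sum_cost s2) 0) frameN // l2 //; exact: N1.
  - by rewrite -[LHS]/(xval (ev sum_cost s2) 0) frameX // l1.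
  - by move=> k nk; rewrite b3 B2.
have x03 : xval s3 0 = xval s 0.
  by rewrite -[LHS]/(xval (ev sum_cost s2) 0) frameX // l1.
have x23 : xval s3 2 = cost A0 by rewrite -x3 /= addr0.
have x13 : xval s3 1 = cost (buf s3) by rewrite buf3 -x3.
have [r1 r2 r3 r4 r5] := record_codeE u v s3 inv3 x13.
set s4 := ev (record_code r u v) s3 in r1 r2 r3 r4 r5 *.
rewrite ev_cons ev_nil; set Q := For 3 _.
(* Either the record has already reached [V] or the current set satisfies the abstract invariant,
   which cannot survive to round n + 1. *)
pose I t (s' : store) := [/\ record_inv u v s', xval s' 0 <= xval s 0,
   xval s' 2 = cost A0 & forall V I, greedy_run u v q K A0 V I ->
     xval s' 0 <= V \/ I t (buf s')].
suff [h1 h2 _ h3] : I n.+1 (ev Q s4).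
  split=> // A V J -> run; case: (h3 V J run) => //.
  by case: run => _ _ stop _ /stop; rewrite ltnn.
apply: (@ev_For R n r c b f I) => //.
  split=> //; first by rewrite -x03.
  - by rewrite -x23.
  - move=> V J [g1 g2 _ _]; rewrite [buf _]r2 buf3.
    have [rel|nrel] := boolP (relaxed R n r b f (u%:R / v%:R) A0); last by right; exact: g2.
    by left; apply: (le_trans (r5 _)); rewrite buf3 //; exact: g1.
move=> t s5 tn _ [i1 i2 i3 i4]; rewrite 3!ev_cons ev_nil.
have n5 : nval s5 0 = n by case: i1.
have [ch hi] := step_codeE q K s5 n5; set s6 := ev (step_code _ _ _) s5 in ch hi *.
have x6 := sum_costE s6; set s7 := ev sum_cost s6 in x6 *.
have b7 : bval s7 = bval s6 by apply: frameB.
have buf7 : buf s7 = buf s6 by apply: buf_eq => k _; rewrite b7.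
have x07 : xval s7 0 = xval s5 0 by rewrite /s7 /s6 !frameX.
have x27 : xval s7 2 = cost A0 by rewrite -i3 /s7 /s6 !frameX.
have inv7 : record_inv u v s7.
  apply: record_inv_frame i1 => //; first by rewrite /s7 /s6 !frameN.
  by move=> k nk; rewrite b7 hi.
rewrite -buf7 in x6.
have [k1 k2 k3 k4 k5] := record_codeE u v s7 inv7 x6.
set s8 := ev (record_code r u v) s7 in k1 k2 k3 k4 k5 *.
have le8 : xval s8 0 <= xval s5 0 by rewrite -x07.
split=> //.
- exact: le_trans le8 i2.
- by rewrite -x27.
- move=> V J run; case: (i4 V J run) => [le|Jt]; first by left; exact: le_trans le8 le.
  case: (run) => _ _ _ /(_ _ _ (buf s6) Jt); rewrite -i3 => /(_ ch)[cV [rel|Jt1]].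
    by left; apply: (le_trans (k5 _)); rewrite buf7.
  by right; rewrite [buf _]k2 buf7.
Qed.

Lemma writesN_guess l body : all (fun d => d < 20)%N (writesN body) ->
  all (fun d => d < 20 + l)%N (writesN (guess_code l body)).
Proof.
move=> hb; elim: l => [|l IH] //=; rewrite ltn_add2l ltnSn /=.
by apply: sub_all IH => d; rewrite addnS => /leqW.
Qed.

(** The target tuple [t] agrees with the counters already fixed by the outer loops. The record never
    gets worse, so it suffices that one iteration of each loop hits [t]. *)
Lemma guess_codeE u v q K m l s
    (s' := ev (guess_code l (inner_code r u v q.+1 K m)) s) :
  all (fun d => d < 20)%N (writesN (inner_code r u v q.+1 K m)) ->
  (l <= m)%N -> record_inv u v s ->
  (forall j, (l <= j < m)%N -> (nval s (20 + j) <= n)%N) ->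
  [/\ record_inv u v s', xval s' 0 <= xval s 0 & forall t A V I,
     (forall j, (j < m)%N -> (t j <= n)%N) ->
     (forall j, (l <= j < m)%N -> nval s (20 + j) = t j) ->
     A = [set e : 'I_n | val e \in [seq t j | j <- iota 0 m]] ->
     greedy_run u v q K A V I -> xval s' 0 <= V].
Proof.
rewrite /s' {s'} => small; elim: l s => [|l IH] s lm inv regs.
  have [h1 h2 h3] := inner_codeE u v q K m s inv regs.
  split=> // t A V I tn st AE; apply: h3; rewrite AE; apply/setP => e; rewrite !inE.
  rewrite (_ : [seq t j | j <- _] = [seq nval s (20 + j) | j <- iota 0 m]) //.
  by apply/eq_in_map => j; rewrite mem_iota /= => jm; rewrite st.
set G := guess_code l _ in IH *.
have wG : all (fun d => d < 20 + l)%N (writesN G) := writesN_guess l _ small.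
have wG' j : (l <= j)%N -> (20 + j)%N \notin writesN G.
  move=> lj; apply/negP => /(allP wG); rewrite ltn_add2l ltnNge lj //.
rewrite -/(For (20 + l) G).
pose J x (s' : store) := [/\ record_inv u v s', xval s' 0 <= xval s 0,
  forall j, (l < j < m)%N -> nval s' (20 + j) = nval s (20 + j) &
  forall t A V I, (forall j, (j < m)%N -> (t j <= n)%N) ->
     (forall j, (l < j < m)%N -> nval s (20 + j) = t j) -> (t l < x)%N ->
     A = [set e : 'I_n | val e \in [seq t j | j <- iota 0 m]] ->
     greedy_run u v q K A V I -> xval s' 0 <= V].
suff [h1 h2 _ h3] : J n.+1 (ev (For (20 + l) G) s).
  by split=> // t A V I tn st; apply: h3 => //; rewrite ltnS tn.
apply: (@ev_For R n r c b f J) => //; first exact: wG'.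
  split=> //; first by move=> j /andP[lj _] /=; rewrite eqn_add2l gtn_eqF.
move=> x s1 xn s1x [i1 i2 i3 i4].
have regs1 j : (l <= j < m)%N -> (nval s1 (20 + j) <= n)%N.
  move=> /andP[]; rewrite leq_eqVlt => /orP[/eqP <- _|lj jm]; first by rewrite s1x.
  by rewrite i3 ?lj // regs ?lj.
have [g1 g2 g3] := IH s1 (ltnW lm) i1 regs1.
split.
- by apply: record_inv_frame g1.
- exact: le_trans g2 i2.
- move=> j /andP[lj jm]; rewrite /= eqn_add2l gtn_eqF // frameN; last exact/wG'/ltnW.
  by apply: i3; rewrite lj.
- move=> t A V I tn st; rewrite ltnS leq_eqVlt => /orP[/eqP tl|tl] AE run.
    apply: (g3 t A V I tn _ AE run) => j /andP[]; rewrite leq_eqVlt => /orP[/eqP <- _|lj jm].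
      by rewrite s1x tl.
    by rewrite i3 ?lj // st ?lj.
  exact: le_trans g2 (i4 t A V I tn st tl AE run).
Qed.

(** Only [load_code m] has symbolic length and needs an induction; the rest is decided by
    computation. *)
Lemma inner_small u v q K m :
  all (fun d => d < 20)%N (writesN (inner_code r u v q.+1 K m)) /\
  wf (inner_code r u v q.+1 K m).
Proof.
have [h1 h2] : writesN (load_code m) = [:: 10; 1]%N /\ wf (load_code m).
  rewrite /load_code; move: (iota 0 m) => L.
  have [h1 h2] : writesN (Block [seq Do (SetBit (20 + j) 10) | j <- L]) = [:: 1%N] /\
     wf (Block [seq Do (SetBit (20 + j) 10) | j <- L]) by elim: L => //= j L [-> ->].
  by split=> /=; rewrite ?h1 ?h2.
split.
  rewrite /inner_code -[writesN _]/(writesN clear_code ++ writesN (load_code m) ++ writesN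
    (Block [:: sum_cost; Do (XZero 14); Do (XAdd 2 1 14); record_code r u v;
      For 3 (Block [:: step_code r q.+1 K; sum_cost; record_code r u v])])).
  by rewrite h1.
rewrite -[wf _]/[&& wf clear_code, wf (load_code m) & wf
    (Block [:: sum_cost; Do (XZero 14); Do (XAdd 2 1 14); record_code r u v;
      For 3 (Block [:: step_code r q.+1 K; sum_cost; record_code r u v])])].
by rewrite h2.
Qed.

Lemma wf_main u v q K m : wf (main_code r u v q.+1 K m).
Proof.
have [h1 h2] := inner_small u v q K m.
have h l : wf (guess_code l (inner_code r u v q.+1 K m)).
  elim: l => [|l IH] //; rewrite -[guess_code _ _]/(For (20 + l) (guess_code l _)).
  rewrite -[wf _]/[&& (1 < 20 + l)%N, (20 + l)%N \notin writesN (guess_code l _) & wf (guess_code l _)].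
  rewrite IH andbT /=; apply/negP => /(allP (writesN_guess l _ h1)).
  by rewrite ltnn.
by rewrite -[wf _]/[&& wf init_code, wf (guess_code m _) & wf (Block [:: final_code])] h.
Qed.

Lemma final_codeE s : nval s 0 = n -> buf (ev final_code s) = best s.
Proof.
move=> s0; rewrite /final_code !evE; set s1 := exec (NAdd 7 7 0) _; set Q := For 2 _.
pose I j (t : store) := [/\ nval t 7 = n.+1,
  forall k, (k < j)%N -> bval t k = bval s (k + n.+1)%N &
  forall k, (n < k)%N -> bval t k = bval s k].
suff [_ h1 h2] : I n.+1 (ev Q s1).
  by apply/setP => e; rewrite !inE h1 //; exact: ltnW (ltn_ord e).
apply: (@ev_For R n r c b f I) => //.
  by split=> //=; rewrite s0 add1n.
move=> j t jn tj [t7 h1 h2]; rewrite !evE; split=> //= k kj.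
  rewrite tj; case: eqP => [->|kj']; last by apply: h1; lia.
  by rewrite t7 h2 ?addnS ?ltnS ?leq_addl //; case: (bval s _).
by rewrite tj gtn_eqF ?h2 //; lia.
Qed.

Lemma main_codeE u v q K m (s := ev (main_code r u v q.+1 K m) (init_store R n r)) :
  relaxed R n r b f (u%:R / v%:R) [set: 'I_n] ->
  relaxed R n r b f (u%:R / v%:R) (buf s) /\
  forall (A : {set 'I_n}) V I, (#|A| <= m)%N -> greedy_run u v q K A V I -> cost (buf s) <= V.
Proof.
move=> relT; rewrite /s /main_code 2!ev_cons; set s1 := ev init_code _.
have inv1 : record_inv u v s1.
  rewrite /s1 /init_code ev_cons ev_Do 2!ev_cons; set s2 := exec _ _; set Q := For 2 _.
  pose I j (t : store) := [/\ nval t 10 = 1, nval t 0 = n & forall k, (k < j)%N -> bval t k].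
  have [_ n3 h3] : I n.+1 (ev Q s2).
    apply: (@ev_For R n r c b f I) => //; move=> j t jn tj [h1 h2 h3].
    rewrite ev_Do; split=> //= k kj; rewrite tj h1; case: eqP => // kj'; apply: h3; lia.
  set s3 := ev Q s2 in n3 h3 *; rewrite ev_cons ev_nil.
  have x4 := sum_costE s3; set s4 := ev sum_cost s3 in x4 *.
  have n4 : nval s4 0 = n by rewrite /s4 frameN.
  have b4 : bval s4 = bval s3 by apply: frameB.
  have bufT : buf s4 = [set: 'I_n].
    by apply/setP => e; rewrite !inE b4 h3 //; exact: ltnW (ltn_ord e).
  have [_ g2 g3] := save_codeE s4 n4.
  split; first by rewrite frameN.
    by rewrite g2 bufT.
  by rewrite g3 g2 x4; congr (cost _); apply: buf_eq => k _; rewrite b4.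
have [small _] := inner_small u v q K m.
have [|i1 i2 i3] := guess_codeE u v q K m m s1 small (leqnn m) inv1.
  by move=> j; rewrite leqNgt andNb.
rewrite ev_cons ev_nil; set s2 := ev (guess_code m _) s1 in i1 i2 i3 *.
case: i1 => n2 rel x0; rewrite final_codeE //; split=> // A V I Am run.
(* The tuple lists [A], padded with the value n that denotes no element. *)
pose t j := nth n [seq val e | e in A] j.
rewrite -x0; apply: (i3 t A V I) => //.
- move=> j _; rewrite /t; case: (ltnP j (size [seq val e | e in A])) => jA; last by rewrite nth_default.
  by have /imageP[e _ ->] := mem_nth n jA; exact: ltnW (ltn_ord e).
- by move=> j; rewrite leqNgt andNb.
apply/setP => e; rewrite inE; apply/idP/mapP => [eA|[j]].
  have eI : val e \in [seq val e | e in A] by apply: image_f.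
  exists (index (val e) [seq val e | e in A]); last by rewrite /t nth_index.
  rewrite mem_iota /= add0n; apply: leq_trans Am; rewrite -(size_image val A).
  by rewrite index_mem.
rewrite /t; case: (ltnP j (size [seq val e | e in A])) => jA _; last first.
  by rewrite nth_default // => en; have := ltn_ord e; rewrite -[X in (X < _)%N]/(val e) en ltnn.
by move=> ej; have /imageP[x xA xE] := mem_nth n jA; move: ej; rewrite xE => /val_inj ->.
Qed.

End Specifications.

(** * The theorem *)

(** The covering ratio has to be built from natural constants of the program. Take [v] with (y - x)
    v > 1, then round x v up. *)
Lemma ratio_between (R : realType) (x y : R) : 0 <= x -> x < y ->
  exists u v : nat, x <= u%:R / v%:R /\ u%:R / v%:R < y.
Proof.
move=> x0 xy; have d0 : 0 < y - x by rewrite subr_gt0.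
set v := (Num.bound (y - x)^-1).+1.
have v0 : 0 < v%:R :> R by [].
have hv : 1 < (y - x) * v%:R.
  rewrite mulrC -ltr_pdivrMr // div1r.
  apply: (@lt_le_trans _ _ (Num.bound (y - x)^-1)%:R); last by rewrite ler_nat.
  by apply: archi_boundP; rewrite invr_ge0 ltW.
have xv0 : 0 <= x * v%:R by rewrite mulr_ge0.
exists (Num.truncn (x * v%:R)).+1, v; split.
  by rewrite ler_pdivlMr // ltW // truncnS_gt.
rewrite ltr_pdivrMr // -natr1.
have : (Num.truncn (x * v%:R))%:R <= x * v%:R by rewrite truncn_le.
lra.
Qed.

Theorem theorem1p1 (R : realType) (r : nat) (eps : R) :
  (0 < r)%N -> 0 < eps ->
  exists (prog : seq instr) (C k : nat),
    forall (n : nat) (c : 'I_n -> R) (b : 'I_r -> R)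
           (f : 'I_r -> {set 'I_n} -> R),
      msc_instance c b f -> msc_feasible b f ->
      let T := (C * n.+1 ^ k)%N in
      (* worst-case polynomial running time, for every coin sequence *)
      (forall coins : nat -> bool, halted prog (run c b f coins prog T)) /\
      (* (i) every output satisfies the relaxed covering constraints *)
      (forall (coins : nat -> bool) (i : 'I_r),
         (1 - (expR 1)^-1 - eps) * b i <= f i (@bufset R n (run c b f coins prog T))) /\
      (* (ii) expected cost at most (1 + eps) OPT *)
      expected_output_cost c b f prog T <= (1 + eps) * msc_opt c b f.
Proof.
move=> r0 eps0.
have e_inv : 0 < (expR 1)^-1 :> R by rewrite invr_gt0 expR_gt0.
have e_inv1 : (expR 1)^-1 < 1 :> R by rewrite invf_lt1 ?expR_gt0 // expR_gt1.
(* Staying strictly below 1 - 1/e leaves the slack from which [delta] is obtained. *)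
have [u [v []]] : exists u v : nat, Num.max 0 (1 - (expR 1)^-1 - eps) <= u%:R / v%:R :> R /\
    u%:R / v%:R < 1 - (expR 1)^-1 :> R.
  apply: ratio_between; first by rewrite le_max lexx.
  by rewrite gt_max; apply/andP; split; lra.
rewrite ge_max => /andP[rho0 rho_ge] rho_lt; set rho := u%:R / v%:R in rho0 rho_ge rho_lt.
have [delta [q [delta0 delta1 exp_small]]] := potential_parameters R r rho r0 rho0 rho_lt.
have rho1 : rho < 1 by lra.
set K := (Num.bound eps^-1).+1.
have Keps : K%:R^-1 <= eps.
  rewrite -[eps]invrK lef_pV2 ?posrE ?invr_gt0 //.
  apply: (@le_trans _ _ (Num.bound eps^-1)%:R); last by rewrite ler_nat.
  by apply/ltW/archi_boundP; rewrite invr_ge0 ltW.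
have th0 : 0 < delta * (1 - rho) ^+ q.+1 by rewrite mulr_gt0 // exprn_gt0 // subr_gt0.
(* Dividing by q + 1 instead of q keeps [eta] positive when q = 0. *)
set eta := delta * (1 - rho) ^+ q.+1 / (r%:R * q.+1%:R).
have rq0 : 0 < r%:R * q.+1%:R :> R by rewrite mulr_gt0 // ltr0n.
have eta0 : 0 < eta by rewrite divr_gt0.
have eta_small : r%:R * q%:R * eta <= delta * (1 - rho) ^+ q.+1.
  rewrite /eta mulrA ler_pdivrMr // [leRHS]mulrC; apply: ler_wpM2r; first exact: ltW.
  by rewrite ler_pM2l ?ltr0n // ler_nat.
set L := Num.bound (r%:R / eta).
have Leta : r%:R < L%:R * eta.
  by rewrite -ltr_pdivrMr //; apply: archi_boundP; rewrite divr_ge0 // ltW.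
set p := main_code r u v q.+1 K (K + L).
have wp : wf p := wf_main r u v q K (K + L).
have [C [k timep]] := time_poly p.
exists (compile 0 p), C, k => n c b f inst feas T.
have runp coins := run_compile R n r c b f p coins T wp (timep n).
have relT : relaxed R n r b f rho [set: 'I_n].
  case: inst => _ [b0 hf]; case: feas => S /forallP feasS; apply/forallP => i.
  apply: (@le_trans _ _ (b i)); first by rewrite ler_piMl // ltW.
  by apply: (le_trans (feasS i)); have [_ [mono _]] := hf i; apply: mono; exact: subsetT.
have [rel out] := main_codeE R n r c b f inst u v q K (K + L) relT.
split; first by move=> coins; case: (runp coins).
split=> [coins i|].
  have [_ ->] := runp coins; apply: le_trans (forallP rel i).
  by apply: ler_wpM2r => //; case: inst => _ [].
have [opt opt_feas opt_cost] := msc_opt_attained R n r c b f inst feas.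
have [A [Aopt AKL cheap small]] := good_guess R n r c b f inst opt K L eta (ltW eta0) Leta.
have cost_opt : 0 <= set_cost c opt := cost_ge0 R n r c b f inst opt.
have bound : set_cost c (buf R n (ev R n r c b f p (init_store R n r))) <= (1 + eps) * msc_opt c b f.
  apply: (@le_trans _ _ ((1 + K%:R^-1) * set_cost c opt)).
    apply: (out A _ (greedy_inv R n r c b f rho delta q opt A) AKL); split.
    - move=> _; have := cost_ge0 R n r c b f inst (opt :\: A).
      have : 0 <= K%:R^-1 * set_cost c opt by rewrite mulr_ge0 // invr_ge0.
      by have := cost_setD R n c A opt Aopt; lra.
    - exact: greedy_inv_init.
    - exact: greedy_inv_stop.
    - exact: (greedy_step R n r c b f inst rho eta delta q K opt A rho1 (ltW eta0)
        delta0 delta1 eta_small exp_small (ltn0Sn _) opt_feas Aopt cheap small).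
  apply: ler_pM => //; last by rewrite lerD2l.
  by rewrite addr_ge0 // invr_ge0.
(* All 2^T coin sequences yield the same output, so the average inherits [bound]. *)
rewrite /expected_output_cost ler_pdivrMr ?exprn_gt0 //.
apply: (@le_trans _ _ (\sum_(w : {ffun 'I_T -> bool}) (1 + eps) * msc_opt c b f)).
  by apply: ler_sum => w _; have [_ ->] := runp (coins_of w).
by rewrite sumr_const card_ffun card_bool card_ord -[leLHS]mulr_natr natrX.
Qed.
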